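(* Let $d\ge1$, let $\mathcal{W}\subseteq\mathbb{R}^d$ be bounded, and let $\Lambda_k=\frac{1}{n_k}A_k\mathbb{Z}^d+v_k$, $k\in\mathbb{N}$, be a sequence of lattices (with the assumptions on $n_k,A_k,v_k$ and the limit matrix $A$ given in the context). Let $\mathcal{S}_k:\mathcal{W}\cap\Lambda_k\to\mathbb{C}$ be a sequence of functions such that there exist, for every $k\in\mathbb{N}$, functions $g_k:\mathcal{W}\cap\Lambda_k\to\mathbb{C}$ and $h_k:\mathcal{W}\to\mathbb{R}$ which satisfy the discrete Laplace assumptions (with point $x_0$, neighborhood $\mathcal{N}_0$ and limit functions $g,h$), as well as the following two assumptions: (i) there exists a constant $C_{\mathcal{S}}\ge0$ such that $|\mathcal{S}_k(x)|\le C_{\mathcal{S}}|g_k(x)|e^{-n_kh_k(x)}$ for all $x\in\mathcal{W}\cap\Lambda_k$ and $k\in\mathbb{N}$; (ii) on the open neighborhood $\mathcal{N}_0$ from the discrete Laplace assumptions, $\lim_{k\to\infty}\|\mathcal{S}_ke^{n_kh_k}-g_k\|_{\infty,\mathcal{N}_0\cap\Lambda_k}=0$. Then $$\lim_{k\to\infty}n_k^{-\frac d2}e^{n_kh(x_0)}\sum_{x\in\mathcal{W}\cap\Lambda_k}\mathcal{S}_k(x)=\frac{(2\pi)^{\frac d2}\,g(x_0)}{|\det(A)|\sqrt{\det(\mathcal{H}\{h\}(x_0))}}.$$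
   Context: Lattices: $\Lambda_k=\frac1{n_k}A_k\mathbb{Z}^d+v_k$, where $(n_k)_k$ is a sequence of positive integers with $n_k\ge k$, $(v_k)_k\subseteq\mathbb{R}^d$ converges to some $v\in\mathbb{R}^d$, and $(A_k)_k\subseteq\mathbb{R}^{d\times d}$ converges to an invertible matrix $A\in\mathbb{R}^{d\times d}$. $\mathcal{H}\{h\}(x)$ denotes the Hessian matrix of $h$ at $x$, and $\|f\|_{\infty,S}=\sup_{x\in S}|f(x)|$. Discrete Laplace assumptions for $\mathcal{W}$, $\Lambda_k$, $g_k:\mathcal{W}\cap\Lambda_k\to\mathbb{C}$, $h_k:\mathcal{W}\to\mathbb{R}$: there exists $x_0\in\mathrm{Int}(\mathcal{W})$ and an open neighborhood $\mathcal{N}_0\subseteq\mathcal{W}$ of $x_0$ such that $h_k\in C^2(\mathcal{N}_0)$ for every $k$, and (i) there exist functions $g\in C(\mathcal{N}_0)$ and $h\in C^2(\mathcal{N}_0)$ with $\lim_{k\to\infty}\|g_k-g\|_{\infty,\mathcal{N}_0\cap\Lambda_k}=0$ and $\lim_{k\to\infty}\|h_k-h\|_{C^2(\mathcal{N}_0)}=0$; (ii) $h_k(x_0)=h(x_0)$ and $\nabla h_k(x_0)=0$ for every $k$, and $\mathcal{H}\{h\}(x_0)$ is strictly positive definite; (iii) for every open neighborhood $\mathcal{N}$ of $x_0$, $\liminf_{k\to\infty}\inf_{x\in\mathcal{W}\setminus\mathcal{N}}h_k(x)>h(x_0)$; (iv) there exist $C_g\ge0$ and $\ell\in\mathbb{N}$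 such that $\|g_k\|_{\infty,\mathcal{W}\cap\Lambda_k}\le C_gk^{\ell}$ for every $k\in\mathbb{N}$. *)

(* Defs.v *)
From HB Require Import structures.
From mathcomp Require Import all_boot all_order all_algebra.
From mathcomp Require Import all_classical all_reals all_analysis.
From mathcomp Require Import complex.
Set Implicit Arguments.
Unset Strict Implicit.
Unset Printing Implicit Defensive.
Import Order.TTheory GRing.Theory Num.Theory.
Import numFieldNormedType.Exports.
Local Open Scope classical_set_scope.
Local Open Scope ring_scope.

Section Calculus.
Context {R : realType} {d : nat}.
Local Notation V := 'cV[R]_d.

Definition partial (i : 'I_d) (f : V -> R) : V -> R := 'D_(delta_mx i 0) f.

Definition gradient (f : V -> R) (x : V) : V := \col_i partial i f x.

Definition hessian (f : V -> R) (x : V) : 'M[R]_d :=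
  \matrix_(i, j) partial i (partial j f) x.

(* C^2 on an open set: all partial derivatives of order at most 2 exist and
   are continuous there.  Only the values of f on N matter when N is open. *)
Definition is_C2 (N : set V) (f : V -> R) : Prop :=
  [/\ {in N, continuous f},
      forall i x, N x -> derivable f x (delta_mx i 0),
      forall i, {in N, continuous (partial i f)},
      forall i j x, N x -> derivable (partial j f) x (delta_mx i 0) &
      forall i j, {in N, continuous (partial i (partial j f))}].

(* The [maxe 0] makes the norm over the empty set 0 instead of -oo. *)
Definition supnorm (S : set V) (f : V -> R) : \bar R :=
  maxe 0%E (ereal_sup [set `|f x|%:E | x in S]).

Definition C2norm (N : set V) (f : V -> R) : \bar R :=
  maxe (supnorm N f)
    (maxe (\big[maxe/0%E]_(i < d) supnorm N (partial i f))
          (\big[maxe/0%E]_(i < d) \big[maxe/0%E]_(j < d)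
             supnorm N (partial i (partial j f)))).

Definition posdef (M : 'M[R]_d) : Prop :=
  forall v : V, v != 0 -> 0 < (v^T *m M *m v) 0 0.

End Calculus.

Section Laplace.
Context {R : realType} {d : nat}.
Local Notation V := 'cV[R]_d.

Definition lattice (n : nat) (A : 'M[R]_d) (v : V) : set V :=
  [set (n%:R)^-1 *: (A *m map_mx intr z) + v | z in [set: 'cV[int]_d]].

(* The natural numbers indexing sequences start at 1, so the assumptions are
   only required for 0 < k.  Functions with domain W or W `&` L k are total
   functions that are only evaluated there. *)
Record discrete_laplace (W : set V) (L : nat -> set V)
    (gk : nat -> V -> R[i]) (hk : nat -> V -> R)
    (x0 : V) (N0 : set V) (g : V -> R[i]) (h : V -> R) : Prop :=
  DiscreteLaplace {
    dl_interior : W° x0 ;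
    dl_open : open N0 ;
    dl_mem : N0 x0 ;
    dl_sub : N0 `<=` W ;
    dl_hk_C2 : forall k, (0 < k)%N -> is_C2 N0 (hk k) ;
    dl_g_cont : {in N0, continuous (g : V -> R[i]^o)} ;
    dl_h_C2 : is_C2 N0 h ;
    dl_gk_cvg :
      supnorm (N0 `&` L k) (fun x => Normc.normc (gk k x - g x)) @[k --> \oo]
        --> 0%E ;
    dl_hk_cvg : C2norm N0 (fun x => hk k x - h x) @[k --> \oo] --> 0%E ;
    dl_hk_x0 : forall k, (0 < k)%N -> hk k x0 = h x0 ;
    dl_grad : forall k, (0 < k)%N -> gradient (hk k) x0 = 0 ;
    dl_posdef : posdef (hessian h x0) ;
    dl_liminf : forall N : set V, open N -> N x0 ->
      ((h x0)%:E <
        limn_einf (fun k => ereal_inf [set (hk k x)%:E | x in W `\` N]))%E ;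
    dl_growth : exists2 Cg : R, 0 <= Cg &
      exists l : nat, forall k, (0 < k)%N ->
        (supnorm (W `&` L k) (fun x => Normc.normc (gk k x))
          <= (Cg * k%:R ^+ l)%:E)%E }.

End Laplace.

(* Main.v *)
Require Import Defs.
From HB Require Import structures.
From mathcomp Require Import all_boot all_order all_algebra.
From mathcomp Require Import all_classical all_reals all_analysis.
From mathcomp Require Import complex.
From mathcomp Require Import ring lra.
From mathcomp Require Import measurable_realfun.
(** This is the Laplace method for sums over lattices.  With [t = n_k ^ (-1/2)],
    a point of the lattice is [x = x0 + t ^+ 2 *: (A_k *m Y)], where [Y] runs
    over the integer vectors shifted by a vector depending on [k].  Near [x0]
    the phase [n_k * (h_k x - h x0)] is, up to a small relative error, equal to
    [t ^+ 2 * qform M Y] with [M = A^T *m H *m A / 2] and [H] the Hessian, and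
    the factor in front of the exponential is close to [g x0].  Thus the
    normalised sum is close to [g x0] times a Gaussian sum
    [\sum_Y t ^+ d * exp (- t ^+ 2 * qform M Y)], a Riemann sum of mesh [t] for
    a Gaussian integral whose value is [sqrt (pi ^+ d / \det M)].  Far from [x0]
    each term is at most [n_k ^ l * exp (- n_k * eta)] up to a constant, and a
    bounded set contains [O(n_k ^ d)] lattice points, so this part vanishes.

    The convergence of the Gaussian sums has to be uniform in the shift of the
    integer vectors, since that shift is not controlled.  In dimension one,
    monotonicity on each half-line bounds the error by [2 * t] for all shifts
    ([gauss_line]).  This uniformity is also what makes an induction on the
    dimension possible ([gauss_sum_bounds]): completing the square in the first
    variable turns the inner sum into a one-dimensional Gaussian sum with a
    shift depending on the other variables, and leaves the Gaussian sum of the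
    Schur complement.  The value of the Gaussian integral on the line thus
    determines the limit in every dimension.

    The error of the phase is controlled by the second derivatives: if
    those of a function with vanishing gradient at [x0] are within [eps] of
    those of a quadratic form on a box around [x0], the function is within
    [d ^+ 2 * eps * |x - x0| ^+ 2] of this form ([quadratic_expansion]).  The
    convergence of [h_k] to [h] in the C^2 norm makes this uniform in [k].  Since
    [qform M] is coercive, the error replaces [M] by [(1 + s) *: M] or
    [(1 - s) *: M] for a small [s], and the value of the Gaussian integral is
    continuous in [s] ([gauss_sum_perturbed]). *)

Set Implicit Arguments.
Unset Strict Implicit.
Unset Printing Implicit Defensive.
Import Order.TTheory GRing.Theory Num.Theory.
Import numFieldNormedType.Exports.
Local Open Scope classical_set_scope.
Local Open Scope complex_scope.
Local Open Scope ring_scope.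

(** * Sums of nonnegative families *)

Lemma esumZl {R : realType} {T : choiceType} (D : set T) (a : T -> \bar R) (r : R) :
  0 <= r -> (forall i, 0 <= a i)%E ->
  (\esum_(i in D) (r%:E * a i) = r%:E * \esum_(i in D) a i)%E.
Proof.
rewrite le_eqVlt => /predU1P[<- _|r0 a0].
  by rewrite mul0e esum1// => i _; rewrite mul0e.
rewrite /esum -ereal_sup_pZl//; congr ereal_sup.
rewrite image_comp; apply: eq_imagel => A _ /=.
by rewrite ge0_mule_fsumr.
Qed.

(** * Gaussian sums on the line *)

Section RiemannSumLine.
Context {R : realType}.
Implicit Types (t s a u w : R).

Lemma gauss_fun_sub t u w : 0 <= t -> 0 <= u -> u <= w ->
  gauss_fun (t * w) <= gauss_fun (t * u).
Proof.
move=> t0 u0 uw; rewrite /gauss_fun ler_expR lerN2.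
by rewrite lerXn2r ?nnegrE ?mulr_ge0 ?ler_wpM2l// (le_trans u0).
Qed.

Lemma gauss_funN (x : R) : gauss_fun (- x) = gauss_fun x.
Proof. by rewrite /gauss_fun sqrrN. Qed.

Let cell t (m : nat) : set R := `[t * m%:R, t * m.+1%:R[%classic.

Let cell_cover t : 0 < t -> \bigcup_m cell t m = `[0, +oo[%classic.
Proof.
move=> t0; rewrite /cell; apply/seteqP; split => x /=; rewrite ?in_itv/= ?andbT.
  by case=> m _ /=; rewrite in_itv/= => /andP[+ _]; apply: le_trans; rewrite mulr_ge0 ?(ltW t0).
move=> x0; exists (Num.truncn (x / t)) => //=; rewrite in_itv/=.
have xt : 0 <= x / t by rewrite divr_ge0 ?(ltW t0).
have /andP[h1 h2] := truncn_itv xt.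
by rewrite mulrC -ler_pdivlMr// h1/= mulrC -ltr_pdivrMr.
Qed.

Let cell_triv t : 0 < t -> trivIset setT (cell t).
Proof.
move=> t0; apply/trivIsetP => i j _ _.
wlog ij : i j / (i < j)%N.
  move=> H nij; case: (ltngtP i j) => [|ji|ijE]; first by move/H; exact.
  - by rewrite setIC H// eq_sym.
  - by rewrite ijE eqxx in nij.
move=> _; rewrite /cell; apply/seteqP; split => x //= -[]; rewrite /= !in_itv/= => /andP[_ xi] /andP[jx _].
have := le_lt_trans jx xi; rewrite ltr_pM2l// ltr_nat ltnS leqNgt => /negP; exact.
Qed.

Let cell_integral t (m : nat) : 0 < t ->
  ((t * gauss_fun (t * m.+1%:R))%:E
     <= \int[@lebesgue_measure R]_(x in cell t m) (gauss_fun x)%:E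
     <= (t * gauss_fun (t * m%:R))%:E)%E.
Proof.
move=> t0.
have mcell : measurable (cell t m) by exact: measurable_itv.
have mu_cell : (@lebesgue_measure R) (cell t m) = t%:E.
  rewrite lebesgue_measure_itv/= lte_fin ltr_pM2l// ltr_nat ltnSn -EFinB -mulrBr.
  by rewrite -natrB// subSnn mulr1.
have inc x : cell t m x -> 0 <= x /\ t * m%:R <= x <= t * m.+1%:R.
  rewrite /cell/= in_itv/= => /andP[h1 h2]; rewrite h1 (ltW h2); split=> //.
  by apply: le_trans h1; rewrite mulr_ge0 ?(ltW t0).
apply/andP; split; rewrite mulrC EFinM -mu_cell -integral_cst//.
- apply: ge0_le_integral => //=.
  + by move=> x _; rewrite lee_fin gauss_fun_ge0.
  + by apply: measurable_funTS; apply: measurableT_comp => //; exact: measurable_gauss_fun.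
  + move=> x /inc [x0 /andP[_ h]]; rewrite lee_fin.
    by have := @gauss_fun_sub 1 x (t * m.+1%:R) ler01 x0 h; rewrite !mul1r.
- apply: ge0_le_integral => //=.
  + by move=> x _; rewrite lee_fin gauss_fun_ge0.
  + by apply: measurable_funTS; apply: measurableT_comp => //; exact: measurable_gauss_fun.
  + move=> x /inc [x0 /andP[h _]]; rewrite lee_fin.
    have := @gauss_fun_sub 1 (t * m%:R) x ler01 _ h; rewrite !mul1r; apply.
    by rewrite mulr_ge0 ?(ltW t0).
Qed.

(** Since [gauss_fun] decreases on the half-line, a Riemann sum with mesh [t]
    lies between the ones sampled at the left and at the right ends of the
    cells.  These two differ by their first term, at most [t], and enclose the
    integral; hence the error bound does not depend on the shift [s]. *)
Lemma gauss_halfline t s : 0 < t -> 0 <= s <= 1 ->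
  ((Num.sqrt pi / 2 - t)%:E <=
     \esum_(m in [set: nat]) (t * gauss_fun (t * (m%:R + s)))%:E
     <= (Num.sqrt pi / 2 + t)%:E)%E.
Proof.
move=> t0 /andP[s0 s1]; rewrite -nneseries_esumT; last first.
  by move=> m; rewrite lee_fin mulr_ge0 ?gauss_fun_ge0 ?(ltW t0).
have pos f : (forall k : nat, 0%E <= (t * gauss_fun (f k))%:E)%E.
  by move=> k; rewrite lee_fin mulr_ge0 ?gauss_fun_ge0 ?(ltW t0).
pose U := (\sum_(m <oo) (t * gauss_fun (t * m.+1%:R))%:E)%E.
pose L := (\sum_(m <oo) (t * gauss_fun (t * m%:R))%:E)%E.
have LU : (L <= t%:E + U)%E.
  rewrite /L nneseries_recl//; last by move=> k _; exact: (pos (fun m => t * m%:R)).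
  apply: leeD.
    by rewrite lee_fin mulr0 ler_piMr ?(ltW t0) ?gauss_fun_le1.
  rewrite -(@nneseries_addn _ (fun m => (t * gauss_fun (t * m%:R))%:E) 1%N); last first.
    exact: (pos (fun m => t * m%:R)).
  by rewrite /U (@eq_eseriesr _ _ (fun m => (t * gauss_fun (t * m.+1%:R))%:E))// => k _; rewrite addn1.
have int : (\int[@lebesgue_measure R]_(x in `[0%R, +oo[) (gauss_fun x)%:E)%E
    = (\sum_(m <oo) \int[@lebesgue_measure R]_(x in cell t m) (gauss_fun x)%:E)%E.
  rewrite -(cell_cover t0) ge0_integral_bigcup//.
  - by move=> k; exact: measurable_itv.
  - by apply: measurable_funTS; apply: measurableT_comp => //; exact: measurable_gauss_fun.
  - by move=> x _; rewrite lee_fin gauss_fun_ge0.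
  - exact: cell_triv.
have UI : (U <= (Num.sqrt pi / 2)%:E)%E.
  rewrite -integral0y_gauss int; apply: lee_nneseries => [k _ _|k _]; first exact: (pos (fun m => t * m.+1%:R)).
  by have /andP[] := cell_integral k t0.
have IL : ((Num.sqrt pi / 2)%:E <= L)%E.
  rewrite -integral0y_gauss int; apply: lee_nneseries => [k _ _|k _].
    by have /andP[+ _] := cell_integral k t0; apply: le_trans; exact: (pos (fun m => t * m.+1%:R)).
  by have /andP[] := cell_integral k t0.
have Us : (U <= \sum_(m <oo) (t * gauss_fun (t * (m%:R + s)))%:E)%E.
  apply: lee_nneseries => [k _ _|k _]; first exact: (pos (fun m => t * m.+1%:R)).
  rewrite lee_fin ler_wpM2l ?(ltW t0)//.
  by rewrite gauss_fun_sub ?(ltW t0) ?addr_ge0// -natr1 lerD2l.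
have sL : (\sum_(m <oo) (t * gauss_fun (t * (m%:R + s)))%:E <= L)%E.
  apply: lee_nneseries => [k _ _|k _]; first exact: (pos (fun m => t * (m%:R + s))).
  rewrite lee_fin ler_wpM2l ?(ltW t0)//.
  by rewrite gauss_fun_sub ?(ltW t0)// lerDl.
apply/andP; split.
- apply: le_trans Us; rewrite EFinB leeBlDl//.
  exact: le_trans IL LU.
- apply: (le_trans sL); apply: (le_trans LU).
  by rewrite addrC EFinD; apply: leeD.
Qed.

(** Up to an integer translation the shift lies in [0, 1]; by parity, the
    negative indices then form a half-line sum with shift [1 - s]. *)
Lemma gauss_line t s : 0 < t ->
  ((Num.sqrt pi - t *+ 2)%:E <=
     \esum_(m in [set: int]) (t * gauss_fun (t * (m%:~R + s)))%:E
     <= (Num.sqrt pi + t *+ 2)%:E)%E.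
Proof.
move=> t0; wlog s01 : s / 0 <= s <= 1.
  move=> H; have /H {}H : 0 <= s - (Num.floor s)%:~R <= 1.
    have /andP[h1 h2] := floor_itv s.
    by rewrite subr_ge0 h1 lerBlDl ltW// -intrD1.
  rewrite (@reindex_esum R int int setT setT (fun m : int => m - Num.floor s)); last first.
    rewrite setTT_bijective; exists (fun m => m + Num.floor s) => m; first by rewrite subrK.
    by rewrite addrK.
  suff <- : (\esum_(m in [set: int]) (t * gauss_fun (t * (m%:~R + (s - (Num.floor s)%:~R))))%:E
    = \esum_(m in [set: int]) (t * gauss_fun (t * ((m - Num.floor s)%:~R + s)))%:E)%E by [].
  by apply: eq_esum => m _; rewrite rmorphB/= [s - _]addrC addrA.
have pos (m : int) : (0%E <= (t * gauss_fun (t * (m%:~R + s)))%:E)%E.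
  by rewrite lee_fin mulr_ge0 ?gauss_fun_ge0 ?(ltW t0).
rewrite (esumID (range Posz)) ?setTI//.
have -> : ~` (range Posz) = range Negz.
  apply/seteqP; split=> -[] m //=; first by move=> []; exists m.
  - by move=> _; exists m.
  - by case.
  - by move=> _ [].
rewrite !esum_image; try by move=> x y _ _ [].
have /andP[a1 a2] := gauss_halfline t0 s01.
have /(gauss_halfline t0) /andP[b1 b2] : 0 <= 1 - s <= 1.
  by case/andP: s01 => *; apply/andP; split; lra.
have -> : (\esum_(i in [set: nat]) (t * gauss_fun (t * ((Negz i)%:~R + s)))%:E
   = \esum_(m in [set: nat]) (t * gauss_fun (t * (m%:R + (1 - s))))%:E)%E.
  apply: eq_esum => m _; rewrite -gauss_funN -mulrN NegzE; do 3 congr (_ _).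
  by congr (t * _); rewrite mulrNz -pmulrn -natr1; ring.
have -> : Num.sqrt pi - t *+ 2 = (Num.sqrt pi / 2 - t) + (Num.sqrt pi / 2 - t) :> R by field.
have -> : Num.sqrt pi + t *+ 2 = (Num.sqrt pi / 2 + t) + (Num.sqrt pi / 2 + t) :> R by field.
by rewrite !EFinD; apply/andP; split; apply: leeD.
Qed.

Lemma gauss_line_scaled t a s : 0 < t -> 0 < a ->
  ((Num.sqrt (pi / a) - t *+ 2)%:E <=
     \esum_(m in [set: int]) (t * expR (- (t ^+ 2 * (a * (m%:~R + s) ^+ 2))))%:E
     <= (Num.sqrt (pi / a) + t *+ 2)%:E)%E.
Proof.
move=> t0 a0; set b := Num.sqrt a.
have b0 : 0 < b by rewrite sqrtr_gt0.
have := @gauss_line (t * b) s (mulr_gt0 t0 b0).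
have -> : (\esum_(m in [set: int]) (t * b * gauss_fun (t * b * (m%:~R + s)))%:E
  = \esum_(m in [set: int]) (b%:E * (t * expR (- (t ^+ 2 * (a * (m%:~R + s) ^+ 2))))%:E))%E.
  apply: eq_esum => m _; rewrite -EFinM; congr EFin; rewrite /gauss_fun !exprMn.
  by rewrite sqr_sqrtr ?(ltW a0)// -!mulrA; ring.
rewrite esumZl ?(ltW b0)//; last by move=> m; rewrite lee_fin mulr_ge0 ?expR_ge0 ?(ltW t0).
have -> : Num.sqrt pi = b * Num.sqrt (pi / a) :> R.
  by rewrite sqrtrM ?pi_ge0// sqrtrV ?(ltW a0)// -/b mulrCA mulfV ?mulr1// gt_eqF.
have -> : (t * b) *+ 2 = b * (t *+ 2) by rewrite mulrC mulrnAr.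
by rewrite -mulrBr -mulrDr !EFinM !lee_pmul2l.
Qed.

End RiemannSumLine.

(** * The maximum norm of matrices *)

Section MatrixNorm.
Context {R : realType}.

Lemma mx_entry_le {m n} (M : 'M[R]_(m, n)) i j : `|M i j| <= `|M|.
Proof.
rewrite [leRHS]/Num.norm/= mx_normrE.
by apply: (@le_bigmax _ _ _ 0 (fun ij => `|M ij.1 ij.2|) (i, j)).
Qed.

Lemma mx_norm_le {m n} (M : 'M[R]_(m, n)) (b : R) : 0 <= b ->
  (forall i j, `|M i j| <= b) -> `|M| <= b.
Proof.
move=> b0 Mb; rewrite [leLHS]/Num.norm/= mx_normrE.
by apply/bigmax_leP; split=> // -[i j] _; exact: Mb.
Qed.

Lemma normr_sum_le {n} (F : 'I_n -> R) (b : R) :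
  (forall i, `|F i| <= b) -> `|\sum_i F i| <= n%:R * b.
Proof.
move=> Fb; apply: le_trans (ler_norm_sum _ _ _) _.
apply: le_trans (ler_sum _ (fun i _ => Fb i)) _.
by rewrite sumr_const card_ord mulr_natl.
Qed.

Lemma mulmx_norm_le {m n p} (M : 'M[R]_(m, n)) (N : 'M[R]_(n, p)) :
  `|M *m N| <= n%:R * (`|M| * `|N|).
Proof.
apply: mx_norm_le => [|i j]; first by rewrite !mulr_ge0.
rewrite mxE; apply: normr_sum_le => k.
by rewrite normrM ler_pM// mx_entry_le.
Qed.

Lemma trmx_norm {m n} (M : 'M[R]_(m, n)) : `|M^T| = `|M|.
Proof.
apply/eqP; rewrite eq_le; apply/andP; split; apply: mx_norm_le => // i j.
  by rewrite mxE mx_entry_le.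
by rewrite -[M]trmxK mxE trmxK mx_entry_le.
Qed.

End MatrixNorm.

(** * Quadratic forms *)

Section QuadraticForm.
Context {R : realType}.

Definition qform {d} (M : 'M[R]_d) (y : 'cV[R]_d) : R := (y^T *m M *m y) 0 0.

Lemma qformE {d} (M : 'M[R]_d) (y : 'cV[R]_d) :
  qform M y = \sum_i \sum_j M i j * y i 0 * y j 0.
Proof.
rewrite /qform -mulmxA mxE; apply: eq_bigr => i _.
rewrite !mxE mulr_sumr; apply: eq_bigr => j _.
by rewrite mulrCA mulrA.
Qed.

Lemma qform_norm_le {d} (M : 'M[R]_d) (y : 'cV[R]_d) :
  `|qform M y| <= d%:R * (d%:R * (`|M| * `|y| ^+ 2)).
Proof.
rewrite qformE; do 2 apply: normr_sum_le => ?.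
by rewrite !normrM -mulrA expr2 !ler_pM ?mulr_ge0// mx_entry_le.
Qed.

Lemma qformZ {d} (M : 'M[R]_d) (s : R) (y : 'cV[R]_d) :
  qform M (s *: y) = s ^+ 2 * qform M y.
Proof.
by rewrite /qform [(s *: y)^T]linearZ/= -!scalemxAl -scalemxAr !mxE mulrA -expr2.
Qed.

Lemma qform_scale {d} (M : 'M[R]_d) (s : R) (y : 'cV[R]_d) :
  qform (s *: M) y = s * qform M y.
Proof. by rewrite /qform -scalemxAr -scalemxAl mxE. Qed.

Lemma qform_congr {d} (B M : 'M[R]_d) (y : 'cV[R]_d) :
  qform (B^T *m M *m B) y = qform M (B *m y).
Proof. by rewrite /qform trmx_mul !mulmxA. Qed.

Lemma posdef_ge0 {d} (M : 'M[R]_d) (y : 'cV[R]_d) :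
  posdef M -> 0 <= qform M y.
Proof.
move=> pM; have [->|/pM/ltW//] := eqVneq y 0.
by rewrite /qform mulmx0 mxE.
Qed.

End QuadraticForm.

Section SchurComplement.
Context {R : realType} {d : nat} (M : 'M[R]_(1 + d)).
Hypotheses (symM : M^T = M) (posM : posdef M).

Let a : R := ulsubmx M 0 0.
Let b : 'cV[R]_d := dlsubmx M.

Definition schur : 'M[R]_d := drsubmx M - a^-1 *: (b *m b^T).

Definition schur_shift (y : 'cV[R]_d) : R := a^-1 * (b^T *m y) 0 0.

Let ME : M = block_mx a%:M b^T b (drsubmx M).
Proof.
rewrite -[LHS]submxK [ulsubmx M]mx11_scalar; congr block_mx.
by rewrite -[M in LHS]symM -trmx_dlsub.
Qed.

Lemma pivot_gt0 : 0 < a.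
Proof.
have := posM (v := col_mx 1%:M 0).
rewrite {1}ME tr_col_mx mul_row_block mul_row_col.
rewrite !trmx0 !mulmx0 !mul0mx !addr0 trmx1 mul1mx mulmx1 mxE eqxx mulr1n; apply.
apply/eqP => /(congr1 (@usubmx _ _ _ _)); rewrite col_mxKu => /matrixP/(_ 0 0).
by rewrite linear0 !mxE => /eqP; rewrite oner_eq0.
Qed.

Lemma schur_sym : schur^T = schur.
Proof.
rewrite /schur linearB/= linearZ/= trmx_mul trmxK; congr (_ - _).
by rewrite trmx_drsub symM.
Qed.

(** Completing the square in the first variable. *)
Lemma qform_schur (x : R) (y : 'cV[R]_d) :
  qform M (col_mx x%:M y) = a * (x + schur_shift y) ^+ 2 + qform schur y.
Proof.
have pE : y^T *m b = b^T *m y by rewrite -[LHS]trmxK trmx_mul trmxK; apply/matrixP => i j; rewrite !ord1 mxE.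
rewrite /qform {1}ME tr_col_mx mul_row_block mul_row_col tr_scalar_mx /schur.
rewrite mulmxBr mulmxBl -scalemxAr -scalemxAl [y^T *m (b *m b^T)]mulmxA pE.
rewrite -[b^T *m y *m b^T *m y]mulmxA /schur_shift [b^T *m y]mx11_scalar.
set p := (b^T *m y) 0 0.
rewrite !mulmxDl -[x%:M *m b^T *m y]mulmxA [b^T *m y]mx11_scalar -/p.
rewrite -!scalar_mxM !mxE eqxx !mulr1n.
have := gt_eqF pivot_gt0; move: (a) => c /negbT c0.
by field.
Qed.

Lemma schur_posdef : posdef schur.
Proof.
move=> y y0; have := posM (v := col_mx (- schur_shift y)%:M y).
rewrite -/(qform _ _) qform_schur addNr expr0n/= mulr0 add0r; apply.
apply: contra y0 => /eqP/(congr1 (@dsubmx _ _ _ _)).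
by rewrite col_mxKd linear0 => ->.
Qed.

Lemma det_schur : \det M = a * \det schur.
Proof.
have := congr1 determinant (erefl (block_mx 1%:M 0 (- a^-1 *: b) 1%:M *m M)).
rewrite {1}det_mulmx det_lblock !det1 !mul1r => ->.
rewrite {1}ME mulmx_block !mul1mx !mul0mx !addr0 mul_mx_scalar scalerA mulrN.
rewrite mulfV ?gt_eqF ?pivot_gt0// scaleN1r addNr det_ublock det_scalar expr1.
by congr (_ * \det _); rewrite /schur [RHS]addrC scaleNr mulNmx -scalemxAl.
Qed.

End SchurComplement.

(** * Gaussian sums over shifted integer vectors *)

Section GaussianLatticeSum.
Context {R : realType}.

(** The sum is taken in the extended reals, so that the bounds below also give
    its convergence. *)
Definition gauss_sum {d} (M : 'M[R]_d) (t : R) (w : 'cV[R]_d) : \bar R :=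
  \esum_(z in [set: 'cV[int]_d])
    (t ^+ d * expR (- (t ^+ 2 * qform M (map_mx intr z + w))))%:E.

(** For a positive definite [M], the integral of [expR (- qform M y)] over all
    [y]. *)
Definition gauss_mass {d} (M : 'M[R]_d) : R := Num.sqrt (pi ^+ d / \det M).

Lemma gauss_term_ge0 {d} (M : 'M[R]_d) (t : R) (y : 'cV[R]_d) : 0 <= t ->
  0 <= t ^+ d * expR (- (t ^+ 2 * qform M y)).
Proof. by move=> t0; rewrite mulr_ge0 ?exprn_ge0 ?expR_ge0. Qed.

(** Fubini, after completing the square in the exponent. *)
Lemma gauss_sum_schur {d} (M : 'M[R]_(1 + d)) (t : R) (w : 'cV[R]_(1 + d)) :
  M^T = M -> posdef M -> 0 < t ->
  (gauss_sum M t w = \esum_(z in [set: 'cV[int]_d])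
    ((t ^+ d * expR (- (t ^+ 2 * qform (schur M) (map_mx intr z + dsubmx w))))%:E
     * \esum_(m in [set: int])
        (t * expR (- (t ^+ 2 * (ulsubmx M 0 0 * (m%:~R
           + (usubmx w 0 0 + schur_shift M (map_mx intr z + dsubmx w))) ^+ 2))))%:E))%E.
Proof.
move=> symM posM t0.
under [RHS]eq_esum do (rewrite -esumZl ?gauss_term_ge0 ?(ltW t0)//;
  last by move=> m; rewrite lee_fin mulr_ge0 ?expR_ge0 ?(ltW t0)).
rewrite esum_esum; last first.
  by move=> z m _ _; rewrite -EFinM lee_fin !mulr_ge0 ?exprn_ge0 ?expR_ge0 ?(ltW t0).
rewrite /gauss_sum (@reindex_esum R ('cV[int]_d * int)%type 'cV[int]_(1 + d)
   (setT `*`` (fun=> setT)) setT (fun k => col_mx k.2%:M k.1)); last first.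
  split=> //.
  - move=> [z m] [z' m'] _ _ /= /eq_col_mx[/matrixP/(_ 0 0)].
    by rewrite !mxE !mulr1n => -> ->.
  - move=> z _ /=; exists (dsubmx z, usubmx z 0 0) => //=.
    by rewrite -mx11_scalar vsubmxK.
apply: eq_esum => -[z m] _ /=; rewrite -EFinM; congr EFin.
rewrite map_col_mx map_scalar_mx -[in LHS](vsubmxK w) [in LHS](mx11_scalar (usubmx w)).
rewrite add_col_mx -raddfD/= qform_schur// mulrDr opprD expRD [t ^+ (1 + d)]exprS -[m%:~R + _ + _]addrA.
set E1 := expR _; set E2 := expR _; ring.
Qed.

(** Induction on the dimension: by Fubini and [qform_schur], the sum over the
    first variable is a one-dimensional Gaussian sum whose shift depends on the
    others; as [gauss_line_scaled] is uniform in the shift, what remains is the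
    Gaussian sum of the Schur complement, times a nearly constant factor. *)
Lemma gauss_sum_bounds d (M : 'M[R]_d) : M^T = M -> posdef M ->
  0 < \det M /\ exists lo up : R -> R,
    [/\ lo t @[t --> 0^'+] --> gauss_mass M,
        up t @[t --> 0^'+] --> gauss_mass M &
        forall (t : R) w, 0 < t -> 0 <= lo t /\
          ((lo t)%:E <= gauss_sum M t w <= (up t)%:E)%E].
Proof.
elim: d M => [|d IH] M symM posM.
  rewrite det_mx00; split=> //; exists (fun=> 1), (fun=> 1).
  rewrite /gauss_mass det_mx00 expr0 divr1 sqrtr1.
  split; [exact: cvg_cst|exact: cvg_cst|move=> t w t0; split=> //].
  rewrite /gauss_sum.
  have -> : [set: 'cV[int]_0] = [set 0] by apply/seteqP; split=> z //= _; rewrite flatmx0.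
  rewrite esum_set1 ?lee_fin ?gauss_term_ge0 ?(ltW t0)//.
  rewrite qformE big_ord0 mulr0 oppr0 expR0 expr0 mulr1.
  by rewrite lexx.
have [dS [lo [up [clo cup bnd]]]] := IH _ (@schur_sym R d M symM) (@schur_posdef R d M symM posM).
set a := ulsubmx (M : 'M[R]_(1 + d)) 0 0.
have a0 : 0 < a by exact: pivot_gt0.
have detE : \det M = a * \det (schur (M : 'M[R]_(1 + d))) by exact: det_schur.
split; first by rewrite detE mulr_gt0.
have massE : gauss_mass M = Num.sqrt (pi / a) * gauss_mass (schur (M : 'M[R]_(1 + d))).
  rewrite /gauss_mass -sqrtrM ?divr_ge0 ?pi_ge0 ?(ltW a0)//; congr Num.sqrt.
  by rewrite detE exprS; field; rewrite !gt_eqF.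
have t2 : t *+ 2 @[t --> (0 : R)^'+] --> (0 : R).
  apply: cvg_at_right_filter.
  have : t *+ 2 @[t --> (0 : R)] --> (0 : R) *+ 2 by apply: cvgMn; exact: cvg_id.
  by rewrite mul0rn.
(* Truncating at 0 keeps the product of the two lower bounds a lower bound. *)
exists (fun t => Num.max 0 (Num.sqrt (pi / a) - t *+ 2) * lo t).
exists (fun t => (Num.sqrt (pi / a) + t *+ 2) * up t).
rewrite massE; split.
- apply: cvgM => //.
  set u := fun t : R => Num.sqrt (pi / a) - t *+ 2.
  have cu : u t @[t --> 0^'+] --> Num.sqrt (pi / a).
    have := cvgB (@cvg_cst _ (Num.sqrt (pi / a)) _ (0^'+ : set_system R) _) t2.
    by rewrite subr0; exact.
  have -> : (fun t => Num.max 0 (u t)) = (fun t => (u t + `|u t|) / 2).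
    by apply/funext => t; rewrite maxr_absE add0r sub0r normrN.
  have -> : Num.sqrt (pi / a) = (Num.sqrt (pi / a) + `|Num.sqrt (pi / a)|) / 2 :> R.
    by rewrite ger0_norm ?sqrtr_ge0//; field.
  by apply: cvgMr_tmp; exact: (cvgD cu (cvg_norm cu)).
- apply: cvgM => //.
  have := cvgD (@cvg_cst _ (Num.sqrt (pi / a)) _ (0^'+ : set_system R) _) t2.
  by rewrite addr0; exact.
- move=> t w t0; have [lo0 /andP[blo bup]] := bnd t (dsubmx (w : 'cV[R]_(1 + d))) t0.
  split; first by rewrite mulr_ge0 ?le_max ?lexx.
  rewrite (@gauss_sum_schur d M)//.
  have pos z : (0%E <= (t ^+ d * expR (- (t ^+ 2 * qform (schur (M : 'M[R]_(1 + d))) (map_mx intr z + dsubmx (w : 'cV[R]_(1 + d))))))%:E)%E.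
    by rewrite lee_fin gauss_term_ge0 ?(ltW t0).
  have line s := andP (@gauss_line_scaled R t a s t0 a0).
  rewrite !EFinM; apply/andP; split.
  + apply: le_trans (lee_wpmul2l _ blo) _; first by rewrite lee_fin le_max lexx.
    rewrite /gauss_sum -esumZl// ?le_max ?lexx//.
    apply: le_esum => z _; rewrite muleC lee_wpmul2l//.
    rewrite EFin_max ge_max; apply/andP; split.
      by apply: esum_ge0 => m _; rewrite lee_fin mulr_ge0 ?expR_ge0 ?(ltW t0).
    exact: (proj1 (line _)).
  + apply: le_trans (lee_wpmul2l _ bup); last first.
      by rewrite lee_fin addr_ge0 ?mulrn_wge0 ?(ltW t0).
    rewrite /gauss_sum -esumZl// ?addr_ge0 ?mulrn_wge0 ?(ltW t0)//.
    apply: le_esum => z _; rewrite [leRHS]muleC lee_wpmul2l//.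
    exact: (proj2 (line _)).
Qed.

(** By induction on the dimension: [qform_schur] controls the last variables
    through the Schur complement, and then the first one, because its shift is
    bounded by [K] times the norm of the others. *)
Lemma posdef_coercive d (M : 'M[R]_d) : M^T = M -> posdef M ->
  exists2 c : R, 0 < c & forall y, c * `|y| ^+ 2 <= qform M y.
Proof.
elim: d M => [|d IH] M symM posM.
  by exists 1 => // y; rewrite flatmx0 normr0 expr0n mulr0 posdef_ge0.
have [c c0 cS] := IH _ (@schur_sym R d M symM) (@schur_posdef R d M symM posM).
set a := ulsubmx (M : 'M[R]_(1 + d)) 0 0.
have a0 : 0 < a by exact: pivot_gt0.
pose K := a^-1 * (d%:R * `|dlsubmx (M : 'M[R]_(1 + d))|).
have K0 : 0 <= K by rewrite !mulr_ge0// invr_ge0 ltW.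
have Kq y : `|schur_shift (M : 'M[R]_(1 + d)) y| <= K * `|y|.
  rewrite normrM ger0_norm ?invr_ge0 ?(ltW a0)// -mulrA ler_wpM2l ?invr_ge0 ?(ltW a0)//.
  apply: le_trans (mx_entry_le _ _ _) _; apply: le_trans (mulmx_norm_le _ _) _.
  by rewrite trmx_norm mulrA.
clearbody K.
pose C := 2 / a + (2 * K ^+ 2 + 1) / c.
have K2 : 0 <= 2 * K ^+ 2 + 1 by rewrite addr_ge0// mulr_ge0// sqr_ge0.
have C0 : 0 < C by apply: ltr_pwDl; rewrite ?divr_gt0// divr_ge0 ?(ltW c0).
exists C^-1; rewrite ?invr_gt0// => v; rewrite mulrC ler_pdivrMr//.
rewrite -[v](@vsubmxK _ 1 d) (mx11_scalar (usubmx _)).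
set x := usubmx _ 0 0; set y := dsubmx _.
rewrite (@qform_schur R d M)// -/a; set q := schur_shift _ y.
have nv : `|col_mx x%:M y : 'cV[R]_(1 + d)| ^+ 2 <= x ^+ 2 + `|y| ^+ 2.
  have b0 : 0 <= Num.max `|x| `|y| by rewrite le_max normr_ge0.
  have : `|col_mx x%:M y : 'cV[R]_(1 + d)| <= Num.max `|x| `|y|.
    apply: mx_norm_le => // i j; rewrite !ord1 mxE le_max.
    case: (fintype.split i) => k; last by rewrite mx_entry_le orbT.
    by rewrite !ord1 mxE eqxx mulr1n lexx.
  rewrite -(@ler_pXn2r _ 2) ?nnegrE//; move/le_trans; apply.
  case: (leP `|x| `|y|) => _; first by rewrite lerDr sqr_ge0.
  by rewrite real_normK ?num_real// lerDl sqr_ge0.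
have xq : x ^+ 2 <= 2 * (x + q) ^+ 2 + 2 * (K ^+ 2 * `|y| ^+ 2).
  have : q ^+ 2 <= K ^+ 2 * `|y| ^+ 2.
    rewrite -exprMn -[q ^+ 2]real_normK ?num_real//.
    have := Kq y; rewrite -/q => qK; rewrite lerXn2r ?nnegrE//.
    exact: (mulr_ge0 K0 (normr_ge0 y)).
  have := sqr_ge0 (x + q + q); nra.
apply: le_trans nv _; have := cS y; set Q := qform _ _ => cQ.
have Q1 : `|y| ^+ 2 <= Q / c by rewrite ler_pdivlMr// mulrC.
have Q0 : 0 <= Q by apply: le_trans cQ; rewrite mulr_ge0 ?(ltW c0)// sqr_ge0.
have -> : (a * (x + q) ^+ 2 + Q) * C = 2 * (x + q) ^+ 2 + (2 * K ^+ 2 + 1) * (Q / c)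
   + (a * (x + q) ^+ 2 * ((2 * K ^+ 2 + 1) / c) + Q * (2 / a)).
  by rewrite /C; field; rewrite !gt_eqF.
apply: (@le_trans _ _ (2 * (x + q) ^+ 2 + (2 * K ^+ 2 + 1) * (Q / c))); last first.
  rewrite lerDl; apply: addr_ge0; apply: mulr_ge0 => //.
  - by apply: mulr_ge0; [exact: ltW | exact: sqr_ge0].
  - by rewrite divr_ge0 ?(ltW c0).
  - by rewrite divr_ge0 ?(ltW a0).
have := ler_wpM2l K2 Q1; rewrite [X in X <= _]mulrDl mul1r -[2 * _ * _]mulrA => KQ.
apply: (@le_trans _ _ (2 * (x + q) ^+ 2 + (2 * (K ^+ 2 * `|y| ^+ 2) + `|y| ^+ 2))).
  by rewrite addrA lerD2r.
rewrite lerD2l; exact: KQ.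
Qed.

End GaussianLatticeSum.

(** * Gaussian sums with a perturbed exponent *)

Section LocalGaussianSums.
Context {R : realType} {d : nat}.
Implicit Types (M : 'M[R]_d) (w : 'cV[R]_d) (F : set 'cV[int]_d).

Local Notation toR := (map_mx (intr : int -> R)).

Lemma gauss_sum_cvg M (e : R) : M^T = M -> posdef M -> 0 < e ->
  \forall t \near (0 : R)^'+, forall w,
    ((gauss_mass M - e)%:E <= gauss_sum M t w <= (gauss_mass M + e)%:E)%E.
Proof.
move=> symM posM e0; have [_ [lo [up [clo cup bnd]]]] := gauss_sum_bounds symM posM.
move/cvgrPdist_le : clo => /(_ _ e0) clo; move/cvgrPdist_le : cup => /(_ _ e0) cup.
near=> t; move=> w.
have t0 : 0 < t by near: t; exact: nbhs_right_gt.
have [_ /andP[h1 h2]] := bnd t w t0; apply/andP; split.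
- apply: le_trans h1; rewrite lee_fin lerBlDr -lerBlDl.
  by apply: le_trans (ler_norm _) _; near: t.
- apply: (le_trans h2); rewrite lee_fin -lerBlDl.
  by apply: le_trans (ler_norm _) _; rewrite distrC; near: t.
Unshelve. all: by end_near. Qed.

Lemma gauss_massZ M (s : R) : 0 < s ->
  gauss_mass (s *: M) = Num.sqrt (pi ^+ d / \det M / s ^+ d).
Proof.
by move=> s0; rewrite /gauss_mass detZ invfM mulrCA mulrC.
Qed.

Lemma gauss_mass_near M (e : R) : 0 < e ->
  \forall s \near (0 : R), `|gauss_mass ((1 + s) *: M) - gauss_mass M| <= e.
Proof.
move=> e0.
have : Num.sqrt (pi ^+ d / \det M / (1 + s) ^+ d) @[s --> (0 : R)]
    --> Num.sqrt (pi ^+ d / \det M / (1 + 0) ^+ d).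
  apply: continuous_cvg; first exact: sqrt_continuous.
  apply: cvgM; first exact: cvg_cst.
  apply: cvgV; first by rewrite addr0 expr1n oner_neq0.
  apply: (cvg_comp (fun s => 1 + s) (fun x => x ^+ d)); last exact: exprn_continuous.
  by apply: cvgD; [exact: cvg_cst|exact: cvg_id].
rewrite addr0 expr1n divr1 => /cvgrPdist_le/(_ _ e0) H.
near=> s; rewrite gauss_massZ.
  by rewrite distrC; near: s.
have : `|s| < 1 by near: s; exact: (@nbhs0_lt R R^o 1 ltr01).
by rewrite ltr_norml => /andP[+ _]; rewrite -ltrBlDl sub0r.
Unshelve. all: by end_near. Qed.

Lemma fsum_le_gauss_sum M (t b : R) w F (a : 'cV[int]_d -> R) : 0 <= t -> finite_set F ->
  (gauss_sum M t w <= b%:E)%E ->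
  (forall z, F z -> a z <= t ^+ d * expR (- (t ^+ 2 * qform M (toR z + w)))) ->
  \sum_(z \in F) a z <= b.
Proof.
move=> t0 finF Mb Fa; rewrite -lee_fin; apply: le_trans Mb.
apply: esum_ge; exists F => //.
rewrite -fsumEFin// lee_fsum// => z Fz; rewrite lee_fin; exact: Fa.
Qed.

(** A Gaussian is bounded below on balls, so the bound on its sums also bounds
    the number of lattice points in a ball. *)
Lemma lattice_ball_count (r : R) : exists C : R, \forall t \near (0 : R)^'+,
  forall w, let D := [set z : 'cV[int]_d | `|t *: (toR z + w)| <= r] in
  finite_set D /\ \sum_(z \in D) t ^+ d <= C.
Proof.
pose M : 'M[R]_d := 1%:M.
have symM : M^T = M by rewrite trmx1.
have posM : posdef M.
  move=> v v0; rewrite mulmx1 mxE.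
  have /cV0Pn[i vi] := v0.
  rewrite (bigD1 i)//= mxE -expr2 ltr_wpDr ?exprn_even_gt0//.
  by apply: sumr_ge0 => j _; rewrite mxE -expr2 sqr_ge0.
pose K := d%:R * (d%:R * (`|M| * r ^+ 2)).
exists (expR K * (gauss_mass M + 1)).
near=> t; move=> w; set D := [set z : 'cV[int]_d | _].
have t0 : 0 < t by near: t; exact: nbhs_right_gt.
have /(_ w) /andP[_ up] : forall w,
  ((gauss_mass M - 1)%:E <= gauss_sum M t w <= (gauss_mass M + 1)%:E)%E.
  by near: t; exact: gauss_sum_cvg.
have bound F : finite_set F -> F `<=` D ->
    \sum_(z \in F) t ^+ d <= expR K * (gauss_mass M + 1).
  move=> finF FD; rewrite mulrC -ler_pdivrMr ?expR_gt0// mulr_fsuml.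
  apply: (fsum_le_gauss_sum (ltW t0) finF up) => z /FD Dz; rewrite ler_wpM2l ?exprn_ge0 ?(ltW t0)// -expRN ler_expR lerN2.
  rewrite -qformZ; apply: le_trans (ler_norm _) _; apply: le_trans (qform_norm_le _ _) _.
  by rewrite !ler_wpM2l// lerXn2r ?nnegrE// (le_trans _ Dz).
suff finD : finite_set D by split=> //; exact: bound.
apply: contrapT => infD.
have [n /= nC] : exists n : nat, expR K * (gauss_mass M + 1) < n%:R * t ^+ d.
  exists (Num.truncn (expR K * (gauss_mass M + 1) / t ^+ d)).+1.
  by rewrite -ltr_pdivrMr ?exprn_gt0// truncnS_gt.
have [A AD An] := infinite_set_fset n infD.
have := bound _ (finite_fset A) AD.
rewrite fsbig_finite//= set_fsetK big_const_seq count_predT.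
rewrite iter_addr_0 leNgt => /negP; apply; apply: lt_le_trans nC _.
by rewrite -[leRHS]mulr_natl ler_wpM2r ?exprn_ge0 ?(ltW t0)// ler_nat.
Unshelve. all: by end_near. Qed.

(** Only the tail outside [F] has to be bounded.  There
    [qform M (t *: y) >= c * rho ^+ 2 / t ^+ 2] for the shifted vectors [y], so that
    one half of the exponent gives a small factor and the other half is still
    summable. *)
Lemma gauss_local_lower M (e rho : R) : M^T = M -> posdef M -> 0 < e -> 0 < rho ->
  \forall t \near (0 : R)^'+, forall w F, finite_set F ->
    (forall z, `|t *: (t *: (toR z + w))| < rho -> F z) ->
    gauss_mass M - e <=
      \sum_(z \in F) t ^+ d * expR (- (t ^+ 2 * qform M (toR z + w))).
Proof.
move=> symM posM e0 rho0; have [c c0 cM] := posdef_coercive symM posM.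
pose H := 2^-1 *: M.
have symH : H^T = H by rewrite linearZ/= symM.
have posH : posdef H.
  by move=> y y0; rewrite -/(qform _ _) qform_scale mulr_gt0 ?invr_gt0//; exact: posM.
have e2 : 0 < e / 2 by rewrite divr_gt0.
pose K := 2 / (c * rho ^+ 2).
have K0 : 0 < K by rewrite divr_gt0// mulr_gt0// exprn_gt0.
have small : (fun t : R => K * t ^+ 2 * (gauss_mass H + 1)) @ (0 : R)^'+ --> (0 : R).
  apply: cvg_at_right_filter.
  have : (fun t : R => K * t ^+ 2 * (gauss_mass H + 1)) @ (0 : R)
     --> K * (0 : R) ^+ 2 * (gauss_mass H + 1).
    by apply: cvgMr_tmp; apply: cvgMl_tmp; exact: exprn_continuous.
  by rewrite expr0n mulr0 mul0r.
move/cvgrPdist_le : small => /(_ _ e2) small.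
near=> t; move=> w F finF ballF.
have t0 : 0 < t by near: t; exact: nbhs_right_gt.
have /(_ w) /andP[lowM _] : forall w,
    ((gauss_mass M - e / 2)%:E <= gauss_sum M t w <= (gauss_mass M + e / 2)%:E)%E.
  by near: t; exact: gauss_sum_cvg.
have /(_ w) /andP[_ upH] : forall w,
    ((gauss_mass H - 1)%:E <= gauss_sum H t w <= (gauss_mass H + 1)%:E)%E.
  by near: t; exact: gauss_sum_cvg.
have smallt : K * t ^+ 2 * (gauss_mass H + 1) <= e / 2.
  by apply: le_trans (ler_norm _) _; rewrite -[X in `|X|]opprK normrN -sub0r; near: t.
pose a z := t ^+ d * expR (- (t ^+ 2 * qform M (toR z + w))).
pose b z := t ^+ d * expR (- (t ^+ 2 * qform H (toR z + w))).
have a0 z : 0 <= a z by rewrite gauss_term_ge0 ?(ltW t0).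
have b0 z : 0 <= b z by rewrite gauss_term_ge0 ?(ltW t0).
have Kt : 0 <= K * t ^+ 2 := mulr_ge0 (ltW K0) (sqr_ge0 t).
have tail : (\esum_(z in ~` F) (a z)%:E <= (e / 2)%:E)%E.
  apply: (@le_trans _ _ ((K * t ^+ 2)%:E * gauss_sum H t w)%E); last first.
    apply: (@le_trans _ _ ((K * t ^+ 2)%:E * (gauss_mass H + 1)%:E)%E).
      by rewrite lee_wpmul2l// lee_fin.
    by rewrite -EFinM lee_fin.
  rewrite /gauss_sum -esumZl//.
  rewrite esum_mkcond; apply: le_esum => z _; case: ifPn => [|_]; last first.
    by rewrite -EFinM lee_fin mulr_ge0// b0.
  rewrite inE/= => /(contra_not (@ballF z)) /negP; rewrite -leNgt => rz.
  rewrite -EFinM lee_fin mulrCA ler_wpM2l ?exprn_ge0 ?(ltW t0)// -/(qform _ _).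
  rewrite -!qformZ qform_scale; set y := t *: (_ + _) in rz *.
  have Qy : c * rho ^+ 2 / t ^+ 2 <= qform M y.
    apply: le_trans (cM y); rewrite -mulrA ler_wpM2l ?(ltW c0)//.
    rewrite ler_pdivrMr ?exprn_gt0//.
    have -> : `|y| ^+ 2 * t ^+ 2 = `|t *: y| ^+ 2.
      by rewrite [in RHS]normrZ gtr0_norm// exprMn mulrC.
    by rewrite lerXn2r ?nnegrE// ltW.
  have -> : - qform M y = - (2^-1 * qform M y) + - (2^-1 * qform M y) by field.
  rewrite expRD ler_wpM2r ?expR_ge0//.
  have X0 : 0 < c * rho ^+ 2 / t ^+ 2 by rewrite divr_gt0 ?mulr_gt0 ?exprn_gt0.
  have hX : 0 < 2^-1 * qform M y by rewrite mulr_gt0 ?invr_gt0// (lt_le_trans X0).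
  rewrite expRN; apply: (@le_trans _ _ (2^-1 * qform M y)^-1).
    rewrite lef_pV2 ?posrE ?expR_gt0//; apply: le_trans (expR_ge1Dx _).
    by rewrite lerDr.
  have -> : K * t ^+ 2 = (2^-1 * (c * rho ^+ 2 / t ^+ 2))^-1.
    by rewrite /K; field; rewrite !gt_eqF.
  rewrite lef_pV2 ?posrE//; last by apply: mulr_gt0 => //; rewrite invr_gt0.
  by rewrite ler_wpM2l ?invr_ge0.
move: lowM; rewrite /gauss_sum (esumID F)// ?setTI; last by move=> z _; rewrite lee_fin a0.
rewrite -/a esum_fset//; last by move=> z _; rewrite lee_fin a0.
move=> lowM; have := le_trans lowM (leeD (lexx _) tail).
rewrite fsumEFin// -EFinD lee_fin -lerBlDr; apply: le_trans.
by rewrite [X in _ - X]splitr opprD addrA.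
Unshelve. all: by end_near. Qed.

(** The relative error [eps] is absorbed in the factors [1 - s] and [1 + s] of
    the form: by coercivity the sum lies between the Gaussian sums of the forms
    [(1 + s) *: M] and [(1 - s) *: M], up to the tail of the former outside [F].
    The masses of these forms tend to that of [M] as [s] tends to 0. *)
Lemma gauss_sum_perturbed M (eta : R) : M^T = M -> posdef M -> 0 < eta ->
  exists2 eps : R, 0 < eps & forall rho : R, 0 < rho ->
    \forall t \near (0 : R)^'+, forall w F (q : 'cV[int]_d -> R), finite_set F ->
    (forall z, `|t *: (t *: (toR z + w))| < rho -> F z) ->
    (forall z, F z -> `|q z - t ^+ 2 * qform M (toR z + w)|
                        <= eps * (t ^+ 2 * `|toR z + w| ^+ 2)) ->
    `|\sum_(z \in F) t ^+ d * expR (- q z) - gauss_mass M| <= eta.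
Proof.
move=> symM posM eta0; have [c c0 cM] := posdef_coercive symM posM.
have e2 : 0 < eta / 2 by rewrite divr_gt0.
have [s [s0 s1 ms]] : exists s : R, [/\ 0 < s, s < 1 &
    forall s', `|s'| <= s -> `|gauss_mass ((1 + s') *: M) - gauss_mass M| <= eta / 2].
  have /nbhs_ballP[r /= r0 rP] := gauss_mass_near M e2.
  exists (Num.min (r / 2) (1 / 2)); split.
  - by rewrite lt_min !divr_gt0.
  - by rewrite gt_min orbC; apply/orP; left; lra.
  - move=> s' s's; apply: rP; rewrite -ball_normE/= sub0r normrN.
    apply: le_lt_trans s's _; rewrite gt_min; apply/orP; left.
    by rewrite ltr_pdivrMr// mulr_natr mulr2n ltrDl.
exists (s * c); first exact: mulr_gt0.
move=> rho rho0.
have sc a : 0 < a -> (a *: M)^T = a *: M /\ posdef (a *: M).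
  move=> a0; split; first by rewrite linearZ/= symM.
  by move=> y y0; rewrite -/(qform _ _) qform_scale mulr_gt0//; exact: posM.
have [symL posL] : ((1 - s) *: M)^T = (1 - s) *: M /\ posdef ((1 - s) *: M).
  by apply: sc; rewrite subr_gt0.
have [symU posU] : ((1 + s) *: M)^T = (1 + s) *: M /\ posdef ((1 + s) *: M).
  by apply: sc; rewrite addr_gt0.
near=> t; move=> w F q finF ballF qF.
have t0 : 0 < t by near: t; exact: nbhs_right_gt.
have Mq z : F z -> (1 - s) * (t ^+ 2 * qform M (toR z + w)) <= q z
                   <= (1 + s) * (t ^+ 2 * qform M (toR z + w)).
  move=> /qF; rewrite ler_distl.
  have : s * c * (t ^+ 2 * `|toR z + w| ^+ 2) <= s * (t ^+ 2 * qform M (toR z + w)).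
    by rewrite -mulrA ler_wpM2l ?(ltW s0)// mulrCA ler_wpM2l ?sqr_ge0.
  set X := s * c * _; set Q := t ^+ 2 * _ => XQ /andP[h1 h2]; apply/andP; split; lra.
have up : \sum_(z \in F) t ^+ d * expR (- q z) <= gauss_mass ((1 - s) *: M) + eta / 2.
  have /(_ w) /andP[_ up] : forall w, ((gauss_mass ((1 - s) *: M) - eta / 2)%:E
      <= gauss_sum ((1 - s) *: M) t w <= (gauss_mass ((1 - s) *: M) + eta / 2)%:E)%E.
    by near: t; exact: gauss_sum_cvg.
  apply: (fsum_le_gauss_sum (ltW t0) finF up) => z /Mq /andP[h _].
  by rewrite ler_wpM2l ?exprn_ge0 ?(ltW t0)// ler_expR lerN2 qform_scale mulrCA.
have low : gauss_mass ((1 + s) *: M) - eta / 2 <= \sum_(z \in F) t ^+ d * expR (- q z).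
  have /(_ _ _ finF ballF) low : forall w F, finite_set F ->
      (forall z, `|t *: (t *: (toR z + w))| < rho -> F z) ->
      gauss_mass ((1 + s) *: M) - eta / 2 <=
      \sum_(z \in F) t ^+ d * expR (- (t ^+ 2 * qform ((1 + s) *: M) (toR z + w))).
    by near: t; exact: gauss_local_lower.
  apply: (le_trans low); rewrite !fsbig_finite//= big_seq [leRHS]big_seq.
  apply: ler_sum => z; rewrite in_fset_set// inE => /Mq /andP[_ h].
  by rewrite ler_wpM2l ?exprn_ge0 ?(ltW t0)// ler_expR lerN2 qform_scale mulrCA.
have := ms (- s); rewrite normrN gtr0_norm// lexx => /(_ erefl).
have := ms s; rewrite gtr0_norm// lexx => /(_ erefl).
rewrite !ler_distl => /andP[a1 a2] /andP[b1 b2]; apply/andP; split; lra.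
Unshelve. all: by end_near. Qed.

End LocalGaussianSums.

(** * Mean value inequalities on boxes *)

Section MeanValue.
Context {R : realType}.

Lemma mean_value_le (f df : R -> R) (m r : R) :
  (forall s : R, `|s| <= `|r| -> is_derive s 1 f (df s) /\ `|df s| <= m) ->
  `|f r - f 0| <= m * `|r|.
Proof.
move=> fdf.
have step a b : a <= b -> (forall s, a <= s <= b -> `|s| <= `|r|) ->
    `|f b - f a| <= m * `|b - a|.
  move=> ab abr.
  have [||c] := @MVT_segment _ f df a b ab.
  - move=> x; rewrite in_itv/= => /andP[/ltW ax /ltW xb].
    by apply: (proj1 (fdf _ (abr _ _))); rewrite ax xb.
  - apply: derivable_within_continuous => x; rewrite in_itv/= => xab.
    by have [[]] := fdf _ (abr _ xab).
  - rewrite in_itv/= => cab ->; rewrite normrM ler_wpM2r//.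
    by case: (fdf _ (abr _ cab)).
have [r0|r0] := leP 0 r.
  have := step 0 r r0; rewrite subr0; apply=> s /andP[s0 sr].
  by rewrite !ger0_norm.
have := step r 0 (ltW r0); rewrite sub0r normrN distrC; apply=> s /andP[rs s0].
by rewrite !ler0_norm ?(ltW r0)// lerN2.
Qed.

Lemma is_derive_line {V W : normedModType R} (f : V -> W) (x v : V) (s : R) (l : W) :
  is_derive (x + s *: v) v f l -> is_derive s 1 (fun a : R => f (x + a *: v)) l.
Proof.
move=> [df fl].
have E : (fun h : R => h^-1 *: (f (x + (h *: (1 : R) + s) *: v) - f (x + s *: v)))
       = (fun h : R => h^-1 *: (f (h *: v + (x + s *: v)) - f (x + s *: v))).
  apply/funext => h; congr (_ *: (f _ - _)).
  by rewrite scalerDl [h *: (1 : R)]mulr1 addrCA addrA.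
split; first by rewrite /derivable E.
by rewrite -fl /derive E.
Qed.

(** Differentiates linear and quadratic polynomials from their exact increments
    along a line. *)
Lemma is_derive_poly2 {V : normedModType R} (f : V -> R) (x v : V) (a b : R) :
  (forall h : R, f (h *: v + x) - f x = h * (a + h * b)) -> is_derive x v f a.
Proof.
move=> fE.
have cv : (fun h : R => h^-1 *: (f (h *: v + x) - f x)) @ (0 : R)^' --> a.
  have : (fun h : R => a + h * b) @ (0 : R)^' --> a.
    apply: cvg_within_filter.
    have hb : h * b @[h --> (0 : R)] --> 0 * b by apply: cvgMr_tmp; exact: cvg_id.
    have := cvgD (@cvg_cst _ a _ (nbhs (0 : R)) _) hb.
    by rewrite mul0r addr0; exact.
  apply: cvg_trans; apply: near_eq_cvg; near=> h.
  rewrite fE [h^-1 *: _]mulrA mulVf ?mul1r//; near: h; exact: nbhs_dnbhs_neq.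
split; first by apply/cvg_ex; exists a.
exact: cvg_lim.
Unshelve. all: by end_near. Qed.

Section Coordinates.
Context {d : nat}.
Local Notation V := 'cV[R]_d.
Local Notation ev i := (delta_mx i 0 : V).

(** The point [y] is reached from [x0] by changing one coordinate at a time;
    for the maximum norm, the whole path stays in the box. *)
Lemma box_mean_value_le (f : V -> R) (G : 'I_d -> V -> R) (x0 : V) (r m : R) :
  (forall i y, `|y - x0| <= r -> is_derive y (ev i) f (G i y) /\ `|G i y| <= m) ->
  forall y, `|y - x0| <= r -> `|f y - f x0| <= d%:R * (m * `|y - x0|).
Proof.
move=> fG y yr.
pose p k : V := \col_i (if (i < k)%N then y i 0 else x0 i 0).
have p0 : p 0%N = x0 by apply/matrixP => i j; rewrite !ord1 mxE.
have pd : p d = y by apply/matrixP => i j; rewrite !ord1 mxE ltn_ord.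
have pS (k : 'I_d) : p k.+1 = p k + (y k 0 - x0 k 0) *: ev k.
  apply/matrixP => i j; rewrite !ord1 !mxE ltnS leq_eqVlt andbT.
  case: eqVneq => [/val_inj ->|ik].
    by rewrite eqxx ltnn mulr1 addrC subrK.
  by rewrite (negbTE (ik : i != k)) mulr0 addr0.
have ent i : `|y i 0 - x0 i 0| <= `|y - x0| by have := mx_entry_le (y - x0) i 0; rewrite !mxE.
have step (k : 'I_d) : `|f (p k.+1) - f (p k)| <= m * `|y - x0|.
  have m0 : 0 <= m.
    by have [_] := fG k y yr; apply: le_trans.
  have := @mean_value_le (fun s => f (p k + s *: ev k)) (fun s => G k (p k + s *: ev k)) m (y k 0 - x0 k 0).
  rewrite scale0r addr0 -pS => H; apply: le_trans (H _) _; last by rewrite ler_wpM2l.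
  move=> s sk; have : `|p k + s *: ev k - x0| <= r.
    apply: le_trans yr; apply: mx_norm_le => // i j; rewrite !ord1 !mxE andbT.
    case: eqVneq => [->|ik].
      by rewrite ltnn mulr1 addrAC subrr add0r; exact: le_trans sk (ent k).
    by rewrite mulr0 addr0; case: ifP => _; rewrite ?subrr ?normr0.
  by move=> /(fG k) [h1 h2]; split=> //; exact: is_derive_line.
have : f y - f x0 = \sum_(k < d) (f (p k.+1) - f (p k)).
  by rewrite -(big_mkord xpredT (fun k => f (p k.+1) - f (p k))) telescope_sumr// p0 pd.
by move=> ->; exact: normr_sum_le.
Qed.

(** The first derivatives vanish at [x0], so they are [O(|y - x0|)] by the mean
    value inequality, which is then applied once more on the smaller box of
    radius [|y - x0|]. *)
Lemma second_order_box_le (f : V -> R) (G : 'I_d -> V -> R) (H : 'I_d -> 'I_d -> V -> R)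
  (x0 : V) (r eps : R) : (forall i, G i x0 = 0) ->
  (forall i y, `|y - x0| <= r -> is_derive y (ev i) f (G i y)) ->
  (forall i j y, `|y - x0| <= r -> is_derive y (ev i) (G j) (H i j y) /\ `|H i j y| <= eps) ->
  forall y, `|y - x0| <= r -> `|f y - f x0| <= d%:R ^+ 2 * eps * `|y - x0| ^+ 2.
Proof.
move=> G0 fG GH y yr.
have := @box_mean_value_le f G x0 `|y - x0| (d%:R * (eps * `|y - x0|)) _ y (lexx _).
rewrite expr2 [`|y - x0| ^+ 2]expr2 !mulrA; apply=> i z zy; split.
  by apply: fG; exact: le_trans yr.
have := @box_mean_value_le (G i) (fun j => H j i) x0 r eps (fun j => GH j i) z (le_trans zy yr).
rewrite G0 subr0 => /le_trans; apply; rewrite -mulrA ler_wpM2l// ler_wpM2l//.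
have [|_] := GH i i x0 _; last exact: le_trans.
by rewrite subrr normr0 (le_trans _ yr).
Qed.

End Coordinates.
End MeanValue.

(** * Second order expansion *)

Section QuadraticExpansion.
Context {R : realType} {d : nat}.
Local Notation V := 'cV[R]_d.
Local Notation ev i := (delta_mx i 0 : V).

Lemma is_derive_mulmx (M : 'M[R]_d) (x0 y : V) i j :
  is_derive y (ev i) (fun y : V => (M *m (y - x0)) j 0) (M j i).
Proof.
apply: (is_derive_poly2 (b := 0)) => h.
rewrite -[h *: _ + y - x0]addrA mulmxDr mxE addrK mulr0 addr0.
by rewrite -scalemxAr mxE -colE mxE.
Qed.

Lemma is_derive_qform (M : 'M[R]_d) (x0 y : V) i : M^T = M ->
  is_derive y (ev i) (fun y : V => 2^-1 * qform M (y - x0)) ((M *m (y - x0)) i 0).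
Proof.
move=> symM; apply: (is_derive_poly2 (b := 2^-1 * M i i)) => h.
rewrite -[h *: _ + y - x0]addrA; move: (y - x0) => u.
have E1 : ((ev i)^T *m M *m u) 0 0 = (M *m u) i 0.
  by rewrite trmx_delta -mulmxA -rowE mxE.
have E2 : (u^T *m M *m ev i) 0 0 = (M *m u) i 0.
  rewrite -E1; have -> : u^T *m M *m ev i = ((ev i)^T *m M *m u)^T.
    by rewrite !trmx_mul trmxK symM mulmxA.
  by rewrite mxE.
have E3 : ((ev i)^T *m M *m ev i) 0 0 = M i i.
  by rewrite -colE trmx_delta -rowE !mxE.
have -> : qform M (h *: ev i + u) = h ^+ 2 * M i i + 2 * h * (M *m u) i 0 + qform M u.
  have addE (B C : 'M[R]_1) : (B + C) 0 0 = B 0 0 + C 0 0 by rewrite mxE.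
  have scaleE (a : R) (B : 'M[R]_1) : (a *: B) 0 0 = a * B 0 0 by rewrite mxE.
  have -> : qform M (h *: ev i + u) = (((h *: (ev i)^T + u^T) *m M *m (h *: ev i + u)) 0 0).
    by rewrite /qform; congr ((_ *m _ *m _) 0 0); apply/matrixP => p q; rewrite !mxE.
  rewrite !mulmxDl !mulmxDr -!scalemxAl -!scalemxAr !addE !scaleE E1 E2 E3 /qform.
  by ring.
by field.
Qed.

Lemma C2_near (N : set V) (f : V -> R) (x0 : V) (eps : R) :
  open N -> N x0 -> is_C2 N f -> 0 < eps ->
  exists2 r : R, 0 < r & forall y, `|y - x0| <= r -> N y /\
    forall i j, `|partial i (partial j f) y - partial i (partial j f) x0| <= eps.
Proof.
move=> oN Nx0 [_ _ _ _ cf] eps0.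
pose P i j y := `|partial i (partial j f) x0 - partial i (partial j f) y| <= eps.
have H : \forall y \near x0, forall i j, P i j y.
  apply: (@filter_forall _ _ (fun i y => forall j, P i j y) _ (nbhs_filter x0)) => i.
  apply: (@filter_forall _ _ (fun j y => P i j y) _ (nbhs_filter x0)) => j.
  have /cvgrPdist_le/(_ _ eps0) := cf i j x0 (mem_set Nx0).
  exact.
have NN : nbhs x0 N by exact: open_nbhs_nbhs.
have : nbhs x0 (N `&` [set y | forall i j, P i j y]) by exact: (filterI NN H).
move=> /nbhs_ballP[r /= r0 rP]; exists (r / 2); first by rewrite divr_gt0.
move=> y yr; have [|Ny Py] := rP y.
  rewrite -ball_normE/= distrC.
  by apply: le_lt_trans yr _; rewrite ltr_pdivrMr// mulr_natr mulr2n ltrDl.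
split; first exact: Ny.
by move=> i j; rewrite distrC; exact: (Py i j).
Qed.

Lemma is_derive_partial (f : V -> R) (x : V) i :
  derivable f x (ev i) -> is_derive x (ev i) f (partial i f x).
Proof. by move/derivableP. Qed.

(** Both mixed derivatives are limits of the same second difference quotient. *)
Lemma hessian_sym (N : set V) (f : V -> R) (x0 : V) :
  open N -> N x0 -> is_C2 N f -> (hessian f x0)^T = hessian f x0.
Proof.
move=> oN Nx0 C2f; apply/matrixP => i j; rewrite !mxE.
apply/eqP; rewrite -subr_eq0 -normr_le0; apply/ler_addgt0Pr => e e0; rewrite add0r.
have e2 : 0 < e / 2 by rewrite divr_gt0.
have [r r0 rP] := C2_near oN Nx0 C2f e2.
case: C2f => _ df _ ddf _.
pose s := r / 2.
have s0 : 0 < s by rewrite divr_gt0.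
have inr k l (a b : R) : `|a| <= s -> `|b| <= s -> `|x0 + a *: ev k + b *: ev l - x0| <= r.
  move=> a1 b1; rewrite addrC -addrA addKr; apply: le_trans (ler_normD _ _) _.
  have ev1 m : `|ev m| <= 1.
    by apply: mx_norm_le => // p q; rewrite mxE; case: (_ && _); rewrite ?normr1 ?normr0.
  rewrite [r]splitr !normrZ; apply: lerD.
    by rewrite -[leRHS]mulr1 ler_pM.
  by rewrite -[leRHS]mulr1 ler_pM.
pose D k l := f (x0 + s *: ev l + s *: ev k) - f (x0 + s *: ev k) - f (x0 + s *: ev l) + f x0.
have DH k l : `|D k l - s ^+ 2 * partial l (partial k f) x0| <= e / 2 * s ^+ 2.
  pose H := partial l (partial k f) x0.
  have lin (c a : R) : is_derive a 1 (fun a : R => c * a) c.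
    by apply: (is_derive_poly2 (b := 0)) => h; rewrite [h *: (1 : R)]mulr1; ring.
  have := @mean_value_le R (fun a => f (x0 + s *: ev l + a *: ev k) - f (x0 + a *: ev k) - s * H * a)
    (fun a => partial k f (x0 + s *: ev l + a *: ev k) - partial k f (x0 + a *: ev k) - s * H)
    (e / 2 * s) s.
  rewrite (gtr0_norm s0) !scale0r !addr0 mulr0 subr0 => mv.
  have -> : D k l - s ^+ 2 * partial l (partial k f) x0 =
     f (x0 + s *: ev l + s *: ev k) - f (x0 + s *: ev k) - s * H * s - (f (x0 + s *: ev l) - f x0).
    by rewrite /D /H; ring.
  have -> : e / 2 * s ^+ 2 = e / 2 * s * s by ring.
  apply: mv => a as_.
  have ss : `|s| <= s by rewrite gtr0_norm.
  have s00 : `|0 : R| <= s by rewrite normr0 ltW.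
  split.
    have D1 : is_derive a 1 (fun a => f (x0 + s *: ev l + a *: ev k))
        (partial k f (x0 + s *: ev l + a *: ev k)).
      apply: is_derive_line; apply: is_derive_partial; apply: df.
      by case: (rP _ (inr l k s a ss as_)).
    have D2 : is_derive a 1 (fun a => f (x0 + a *: ev k)) (partial k f (x0 + a *: ev k)).
      apply: is_derive_line; apply: is_derive_partial; apply: df.
      by have [] := rP _ (inr k l a 0 as_ s00); rewrite scale0r addr0.
    exact: (is_deriveB (is_deriveB D1 D2) (lin (s * H) a)).
  have := @mean_value_le R (fun b => partial k f (x0 + a *: ev k + b *: ev l) - H * b)
     (fun b => partial l (partial k f) (x0 + a *: ev k + b *: ev l) - H) (e / 2) s.
  rewrite (gtr0_norm s0) !scale0r !addr0 mulr0 subr0 => mv.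
  have -> : partial k f (x0 + s *: ev l + a *: ev k) - partial k f (x0 + a *: ev k) - s * H
    = partial k f (x0 + a *: ev k + s *: ev l) - H * s - partial k f (x0 + a *: ev k).
    by rewrite [x0 + s *: _ + _]addrAC; ring.
  apply: mv => b bs; have [Nab Hab] := rP _ (inr k l a b as_ bs).
  split; last exact: Hab.
  have D1 : is_derive b 1 (fun b => partial k f (x0 + a *: ev k + b *: ev l))
      (partial l (partial k f) (x0 + a *: ev k + b *: ev l)).
    by apply: is_derive_line; apply: is_derive_partial; apply: ddf.
  exact: (is_deriveB D1 (lin H b)).
have Dsym : D j i = D i j by rewrite /D [x0 + s *: ev i + _]addrAC; ring.
have DHji := DH j i; rewrite Dsym in DHji.
have key (X P Q S E : R) : 0 < S -> `|X - S * P| <= E * S -> `|X - S * Q| <= E * S ->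
    `|P - Q| <= E + E.
  move=> S0 XP XQ; rewrite -(ler_pM2r S0) -[S in leLHS]gtr0_norm// -normrM [leRHS]mulrDl.
  have -> : (P - Q) * S = (X - S * Q) - (X - S * P) by ring.
  by apply: le_trans (ler_normB _ _) _; exact: lerD.
rewrite [leRHS]splitr; exact: (key _ _ _ _ _ (exprn_gt0 2 s0) (DH i j) DHji).
Qed.

(** [second_order_box_le] for the difference of [f] and its quadratic part. *)
Lemma quadratic_expansion (N : set V) (f : V -> R) (M : 'M[R]_d) (x0 : V) (r eps : R) :
  is_C2 N f -> M^T = M -> gradient f x0 = 0 ->
  (forall y, `|y - x0| <= r -> N y /\
     forall i j, `|partial i (partial j f) y - M i j| <= eps) ->
  forall y, `|y - x0| <= r ->
    `|f y - f x0 - 2^-1 * qform M (y - x0)| <= d%:R ^+ 2 * eps * `|y - x0| ^+ 2.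
Proof.
move=> [_ df _ ddf _] symM grad0 near_x0 y yr.
pose G i y := partial i f y - (M *m (y - x0)) i 0.
pose H i j y := partial i (partial j f) y - M j i.
have G0 i : G i x0 = 0.
  rewrite /G subrr mulmx0 mxE subr0.
  by have /matrixP/(_ i 0) := grad0; rewrite !mxE.
have dG i z : `|z - x0| <= r ->
    is_derive z (ev i) (fun y => f y - 2^-1 * qform M (y - x0)) (G i z).
  move=> zr; have D1 : is_derive z (ev i) f (partial i f z).
    by apply: is_derive_partial; apply: df; case: (near_x0 z zr).
  exact: (is_deriveB D1 (is_derive_qform x0 z i symM)).
have dH i j z : `|z - x0| <= r -> is_derive z (ev i) (G j) (H i j z) /\ `|H i j z| <= eps.
  move=> zr; have [Nz Hz] := near_x0 z zr; split.
    have D1 : is_derive z (ev i) (partial j f) (partial i (partial j f) z).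
      by apply: is_derive_partial; exact: ddf.
    exact: (is_deriveB D1 (is_derive_mulmx M x0 z i j)).
  by rewrite /H -symM mxE; exact: Hz.
have := second_order_box_le G0 dG dH yr.
have -> : qform M (x0 - x0) = 0 by rewrite subrr /qform mulmx0 mxE.
by rewrite mulr0 subr0 addrAC.
Qed.

End QuadraticExpansion.

Section UniformExpansion.
Context {R : realType} {d : nat}.
Local Notation V := 'cV[R]_d.
Local Notation ev i := (delta_mx i 0 : V).

Lemma supnorm_ge (S : set V) (f : V -> R) x : S x -> (`|f x|%:E <= supnorm S f)%E.
Proof.
move=> Sx; rewrite /supnorm le_max; apply/orP; right.
by apply: ereal_sup_ubound; exists x.
Qed.

Lemma cvge0_near (u : nat -> \bar R) (e : R) : u k @[k --> \oo] --> 0%E -> 0 < e ->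
  \forall k \near \oo, (u k < e%:E)%E.
Proof.
move=> cu e0; apply: (cu [set x | (x < e%:E)%E]).
by apply: open_nbhs_nbhs; split; [exact: open_ereal_lt_ereal | rewrite /= lte_fin].
Qed.

Lemma supnorm_cvg0 (S : nat -> set V) (f : nat -> V -> R) (e : R) :
  supnorm (S k) (f k) @[k --> \oo] --> 0%E -> 0 < e ->
  \forall k \near \oo, forall x, S k x -> `|f k x| <= e.
Proof.
move=> cf e0; have := cvge0_near cf e0; apply: filterS => k ke x Sx.
by rewrite -lee_fin; exact: le_trans (@supnorm_ge (S k) (f k) x Sx) (ltW ke).
Qed.

Lemma supnorm_le_C2norm (N : set V) (f : V -> R) i j :
  (supnorm N (partial i (partial j f)) <= C2norm N f)%E.
Proof.
rewrite /C2norm; set b1 := bigop _ _ _; set b2 := bigop _ _ _.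
have : (supnorm N (partial i (partial j f)) <= b2)%E.
  apply: (@le_trans _ _ (\big[maxe/0%E]_(j < d) supnorm N (partial i (partial j f)))).
    exact: (le_bigmax _ (fun j => supnorm N (partial i (partial j f))) j).
  exact: (le_bigmax _ (fun i => \big[maxe/0%E]_(j < d) supnorm N (partial i (partial j f))) i).
by move=> h; rewrite !le_max h !orbT.
Qed.

Lemma partial2B (N : set V) (f g : V -> R) i j x : open N -> N x ->
  is_C2 N f -> is_C2 N g ->
  partial i (partial j (fun y => f y - g y)) x
    = partial i (partial j f) x - partial i (partial j g) x.
Proof.
move=> oN Nx [_ df _ ddf _] [_ dg _ ddg _].
have NN : nbhs x N by exact: open_nbhs_nbhs.
have E : \near x, partial j (fun y => f y - g y) x = (partial j f - partial j g) x.
  by apply: filterS NN => y Ny; rewrite /partial (deriveB (df j y Ny) (dg j y Ny)).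
rewrite {1}/partial (near_eq_derive _ E).
exact: (deriveB (ddf i j x Nx) (ddg i j x Nx)).
Qed.

(** The C^2 distance of [hk k] to [h] and the continuity of the second
    derivatives of [h] each contribute half of the error on the Hessian. *)
Lemma uniform_quadratic_expansion (N : set V) (hk : nat -> V -> R) (h : V -> R)
    (x0 : V) (eps : R) : open N -> N x0 ->
  (forall k, (0 < k)%N -> is_C2 N (hk k)) -> is_C2 N h ->
  C2norm N (fun x => hk k x - h x) @[k --> \oo] --> 0%E ->
  (forall k, (0 < k)%N -> gradient (hk k) x0 = 0) -> 0 < eps ->
  exists r : R, [/\ 0 < r, forall y, `|y - x0| <= r -> N y &
    \forall k \near \oo, forall y, `|y - x0| <= r ->
      `|hk k y - hk k x0 - 2^-1 * qform (hessian h x0) (y - x0)|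
        <= eps * `|y - x0| ^+ 2].
Proof.
move=> oN Nx0 C2hk C2h ck gk eps0.
pose e := eps / (d%:R ^+ 2 + 1) / 2.
have D0 : 0 < d%:R ^+ 2 + 1 :> R by rewrite ltr_wpDl ?sqr_ge0.
have e0 : 0 < e by rewrite !divr_gt0.
have [r r0 rP] := C2_near oN Nx0 C2h e0.
exists r; split=> // [y /rP[]//|].
have ck' := cvge0_near ck e0.
near=> k; move=> y yr.
have k0 : (0 < k)%N by near: k; exists 1%N.
have Ck : (C2norm N (fun x => (hk k x - h x)%R) < e%:E)%E by near: k.
have near_x0 z : `|z - x0| <= r -> N z /\
    forall i j, `|partial i (partial j (hk k)) z - hessian h x0 i j| <= e + e.
  move=> zr; have [Nz Hz] := rP z zr; split=> // i j; rewrite mxE.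
  have : `|partial i (partial j (fun x => hk k x - h x)) z| <= e.
    rewrite -lee_fin; apply: (le_trans (@supnorm_ge N (partial i (partial j (fun x => hk k x - h x))) z Nz)).
    exact: le_trans (supnorm_le_C2norm N (fun x => hk k x - h x) i j) (ltW Ck).
  rewrite (partial2B _ _ oN Nz (C2hk k k0) C2h) => h1.
  by have := lerD h1 (Hz i j); apply: le_trans; apply: le_trans (ler_normD _ _); rewrite addrA subrK.
have symH := hessian_sym oN Nx0 C2h.
have := quadratic_expansion (C2hk k k0) symH (gk k k0) near_x0 yr.
move=> /le_trans; apply; rewrite ler_wpM2r ?sqr_ge0//.
have -> : e + e = eps / (d%:R ^+ 2 + 1) by rewrite /e -splitr.
by rewrite mulrCA ler_piMr ?(ltW eps0)// ler_pdivrMr// mul1r lerDl.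
Unshelve. all: by end_near. Qed.

End UniformExpansion.

(** * Limits of sequences *)

Section Limits.
Context {R : realType}.

Lemma limn_einf_gt (u : nat -> \bar R) (a : R) : (a%:E < limn_einf u)%E ->
  exists2 eta : R, 0 < eta & \forall k \near \oo, ((a + eta)%:E <= u k)%E.
Proof.
rewrite limn_einf_lim (cvg_lim _ (@cvg_einfs_sup R u))//.
move=> /ereal_sup_gt[_ [N _ <-]] aN.
have [eta eta0 etaN] : exists2 eta : R, 0 < eta & ((a + eta)%:E <= einfs u N)%E.
  case: (einfs u N) aN => [b||]//; last by exists 1; rewrite ?leey.
  rewrite lte_fin => ab; exists (b - a); first by rewrite subr_gt0.
  by rewrite addrC subrK.
exists eta => //; exists N => // k /= Nk; apply: le_trans etaN _.
by apply: ereal_inf_lbound; exists k.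
Qed.

(** [1 + y <= expR y] for [y = x / c], raised to the power [p.+1]. *)
Lemma exprn_expR_le (p : nat) (eta : R) : 0 < eta ->
  exists2 C : R, 0 <= C & forall x : R, 0 < x -> x ^+ p * expR (- (x * eta)) <= C / x.
Proof.
move=> eta0; pose c := p.+1%:R / eta.
have c0 : 0 < c by rewrite divr_gt0.
exists (c ^+ p.+1); first by rewrite exprn_ge0 ?(ltW c0).
move=> x x0; rewrite ler_pdivlMr// mulrAC -exprSr expRN ler_pdivrMr ?expR_gt0//.
have -> : x * eta = p.+1%:R * (x / c).
  by rewrite /c; field; rewrite gt_eqF//= pnatr_eq0.
rewrite expRM_natl -exprMn; apply: lerXn2r; rewrite ?nnegrE ?(ltW x0)//.
  exact: (mulr_ge0 (ltW c0) (expR_ge0 _)).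
rewrite mulrC -ler_pdivrMr//; apply: le_trans (expR_ge1Dx _).
by rewrite lerDr.
Qed.

End Limits.

(** * Lattice points *)

Section LatticePoints.
Context {R : realType} {d : nat}.
Local Notation V := 'cV[R]_d.
Local Notation toR := (map_mx (intr : int -> R)).

Lemma near0_right (P : R -> Prop) : (\forall t \near (0 : R)^'+, P t) ->
  exists2 e : R, 0 < e & forall t, 0 < t < e -> P t.
Proof.
move=> [e /= e0 eP]; exists e => // t /andP[t0 te]; apply: eP => //=.
by rewrite /ball_/= sub0r normrN gtr0_norm.
Qed.

(** [A] is bounded below by [1 / K] on unit vectors; a perturbation of operator
    norm at most [1 / (2 * K)] halves this bound at worst. *)
Lemma invertible_lower_bound (A : 'M[R]_d) : A \in unitmx ->
  exists2 K : R, 0 < K & exists2 e : R, 0 < e &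
    forall B : 'M[R]_d, `|B - A| <= e -> forall y : V, `|y| <= K * `|B *m y|.
Proof.
move=> uA; pose K := d%:R * `|invmx A| + 1.
have K0 : 0 < K by rewrite ltr_wpDl// mulr_ge0.
have AK (y : V) : `|y| <= K * `|A *m y|.
  rewrite -{1}[y](mulKmx uA); apply: le_trans (mulmx_norm_le _ _) _.
  by rewrite mulrA ler_wpM2r// lerDl.
have D0 : 0 < d%:R + 1 :> R by rewrite ltr_wpDl.
exists (2 * K); first by rewrite mulr_gt0.
exists (2 * K * (d%:R + 1))^-1; first by rewrite invr_gt0 !mulr_gt0.
move=> B BA y.
have By : `|(B - A) *m y| <= (2 * K)^-1 * `|y|.
  apply: le_trans (mulmx_norm_le _ _) _; rewrite mulrA ler_wpM2r//.
  apply: (@le_trans _ _ ((d%:R + 1) * (2 * K * (d%:R + 1))^-1)).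
    by apply: ler_pM => //; rewrite lerDl.
  by rewrite invfM mulrCA divff ?mulr1// gt_eqF.
have : `|A *m y| <= `|B *m y| + (2 * K)^-1 * `|y|.
  have -> : A *m y = B *m y - (B - A) *m y by rewrite mulmxBl opprB addrC subrK.
  by apply: le_trans (ler_normB _ _) _; rewrite lerD2l.
move=> /(ler_wpM2l (ltW K0)) /(le_trans (AK y)).
have -> : K * (`|B *m y| + (2 * K)^-1 * `|y|) = K * `|B *m y| + `|y| / 2.
  by field; rewrite gt_eqF.
lra.
Qed.

Lemma lower_bound_unitmx (B : 'M[R]_d) (K : R) :
  (forall y : V, `|y| <= K * `|B *m y|) -> B \in unitmx.
Proof.
move=> BK; rewrite -unitmx_tr -row_free_unit -kermx_eq0.
apply/eqP/row_matrixP => i; rewrite row0.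
have : row i (kermx B^T) *m B^T = 0 by rewrite -row_mul mulmx_ker row0.
set u := row i _ => uB; have Bu : B *m u^T = 0 by rewrite -[LHS]trmxK trmx_mul trmxK uB trmx0.
have := BK u^T; rewrite Bu normr0 mulr0 normr_le0 => /eqP/(congr1 trmx).
by rewrite trmxK trmx0.
Qed.

Definition lattice_point (n : nat) (B : 'M[R]_d) (v : V) (z : 'cV[int]_d) : V :=
  n%:R^-1 *: (B *m toR z) + v.

(** The shift that writes the displacement from [x0] to a lattice point as the
    image of a shifted integer vector. *)
Definition lattice_shift (n : nat) (B : 'M[R]_d) (v x0 : V) : V :=
  n%:R *: (invmx B *m (v - x0)).

Lemma lattice_pointE n B v x0 z : (0 < n)%N -> B \in unitmx ->
  lattice_point n B v z - x0 = B *m (n%:R^-1 *: (toR z + lattice_shift n B v x0)).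
Proof.
move=> n0 uB; rewrite scalerDr scalerA mulVf ?pnatr_eq0 -?lt0n// scale1r.
by rewrite mulmxDr mulKVmx// -scalemxAr addrA.
Qed.

Lemma lattice_point_inj n B v : (0 < n)%N -> B \in unitmx ->
  injective (lattice_point n B v).
Proof.
move=> n0 uB z z' /addIr /scalerI E; have {E} : B *m toR z = B *m toR z'.
  by apply: E; rewrite invr_eq0 pnatr_eq0 -lt0n.
move=> /(can_inj (mulKmx uB)) /matrixP E; apply/matrixP => i j.
by have := E i j; rewrite !mxE => /intr_inj.
Qed.

Variables (n : nat -> nat) (A_ : nat -> 'M[R]_d) (v_ : nat -> V) (A : 'M[R]_d) (x0 : V).
Hypothesis hn : forall k, (0 < k)%N -> (0 < n k)%N /\ (k <= n k)%N.
Hypothesis hA : A_ k @[k --> \oo] --> A.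
Hypothesis uA : A \in unitmx.

Lemma n_large (X : R) : \forall k \near \oo, X < (n k)%:R.
Proof.
near=> k; have k0 : (0 < k)%N by near: k; exists 1%N.
apply: (@lt_le_trans _ _ k%:R); last by rewrite ler_nat; case: (hn k0).
by near: k; exact: nbhs_infty_gtr.
Unshelve. all: by end_near. Qed.

Lemma near_n_inv (P : R -> Prop) : (\forall t \near (0 : R)^'+, P t) ->
  \forall k \near \oo, P (n k)%:R^-1.
Proof.
move=> /near0_right[e e0 eP]; have := n_large e^-1; apply: filterS => k kn.
have n0 : 0 < (n k)%:R :> R by apply: lt_trans kn; rewrite invr_gt0.
by apply: eP; rewrite invr_gt0 n0 -[ltRHS]invrK ltf_pV2 ?posrE ?invr_gt0.
Qed.

Lemma near_sqrt_n_inv (P : R -> Prop) : (\forall t \near (0 : R)^'+, P t) ->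
  \forall k \near \oo, P (Num.sqrt (n k)%:R)^-1.
Proof.
move=> /near0_right[e e0 eP]; have := n_large (e ^- 2); apply: filterS => k kn.
have n0 : 0 < (n k)%:R :> R by apply: lt_trans kn; rewrite invr_gt0 exprn_gt0.
apply: eP; rewrite invr_gt0 sqrtr_gt0 n0 -[ltRHS]invrK ltf_pV2 ?posrE ?invr_gt0 ?sqrtr_gt0//.
by rewrite -(@ltr_pXn2r _ 2) ?nnegrE ?sqrtr_ge0 ?invr_ge0 ?(ltW e0)// sqr_sqrtr ?(ltW n0)// exprVn.
Qed.

Lemma near_matrix (e : R) : 0 < e -> \forall k \near \oo, `|A_ k - A| <= e.
Proof.
by move=> e0; move/cvgrPdist_le : hA => /(_ _ e0); apply: filterS => k; rewrite distrC.
Qed.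

(** A lattice point at bounded distance from [x0] comes from a shifted integer
    vector of norm [O(n k)], so this is [lattice_ball_count] with mesh
    [1 / n k]. *)
Lemma lattice_count (b : R) : exists C : R, \forall k \near \oo,
  A_ k \in unitmx /\
  let D := [set z | `|lattice_point (n k) (A_ k) (v_ k) z - x0| <= b] in
  finite_set D /\ \sum_(z \in D) ((n k)%:R^-1 : R) ^+ d <= C.
Proof.
have [K K0 [e e0 eK]] := invertible_lower_bound uA.
have [C HC] := @lattice_ball_count R d (K * b).
exists C; have := near_n_inv HC; have := near_matrix e0.
have : \forall k \near \oo, (0 < k)%N by exists 1%N.
apply: filterS3 => k k0 kA kC.
have [n0 _] := hn k0.
have uk : A_ k \in unitmx by exact: lower_bound_unitmx (eK _ kA).
split=> //; have [finD sumD] := kC (lattice_shift (n k) (A_ k) (v_ k) x0).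
set D := [set z | _]; set D' := [set z | _] in finD sumD.
have DD' : D `<=` D'.
  move=> z; rewrite /D/= lattice_pointE// => zb.
  apply: le_trans (eK _ kA _) _; by rewrite ler_wpM2l// ltW.
have finD0 : finite_set D by exact: sub_finite_set finD.
split=> //; apply: le_trans sumD.
rewrite (fsbigID D D')//= setIC (setIidl DD') lerDl.
by apply: fsumr_ge0 => z _; rewrite exprn_ge0.
Qed.

End LatticePoints.

(** * The sum near the minimum *)

Section LocalSum.
Context {R : realType} {d : nat}.
Local Notation V := 'cV[R]_d.
Local Notation toR := (map_mx (intr : int -> R)).

Lemma qform_dist_le (H : 'M[R]_d) (x z : V) :
  `|qform H x - qform H z| <= d%:R ^+ 2 * `|H| * `|x - z| * (`|x| + `|z|).
Proof.
have bil (p q : V) : `|(p^T *m H *m q) 0 0| <= d%:R ^+ 2 * `|H| * `|p| * `|q|.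
  apply: le_trans (mx_entry_le _ _ _) _; apply: le_trans (mulmx_norm_le _ _) _.
  rewrite expr2 -!mulrA ler_wpM2l// !mulrA ler_wpM2r//.
  by apply: le_trans (mulmx_norm_le _ _) _; rewrite trmx_norm -mulrA [`|H| * _]mulrC.
have -> : qform H x - qform H z = ((x - z)^T *m H *m x) 0 0 + (z^T *m H *m (x - z)) 0 0.
  rewrite /qform linearB/= !mulmxBl mulmxBr !mxE; ring.
apply: le_trans (ler_normD _ _) _; rewrite mulrDr; apply: lerD; first exact: bil.
by apply: le_trans (bil _ _) _; rewrite mulrAC.
Qed.

Lemma gauss_mass_congr (H A : 'M[R]_d) : A \in unitmx -> 0 < \det H ->
  gauss_mass (2^-1 *: (A^T *m H *m A))
    = (2 * pi) `^ (d%:R / 2) / (`|\det A| * Num.sqrt (\det H)).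
Proof.
rewrite unitmxE unitfE => A0 H0; rewrite /gauss_mass detZ !det_mulmx det_tr.
have -> : (2 * pi) `^ (d%:R / 2) = Num.sqrt ((2 * pi) ^+ d) :> R.
  by rewrite powRrM powR12_sqrt ?powR_ge0// powR_mulrn// mulr_ge0// pi_ge0.
have X0 : 0 <= \det A ^+ 2 * \det H := mulr_ge0 (sqr_ge0 _) (ltW H0).
rewrite -sqrtr_sqr -sqrtrM ?sqr_ge0// -sqrtrV//.
rewrite -sqrtrM ?exprn_ge0 ?mulr_ge0 ?pi_ge0//; congr Num.sqrt.
by rewrite exprMn exprVn; field; rewrite A0 gt_eqF//= expf_neq0.
Qed.

Variables (n : nat -> nat) (A_ : nat -> 'M[R]_d) (v_ : nat -> V) (A : 'M[R]_d) (x0 : V).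
Hypothesis hn : forall k, (0 < k)%N -> (0 < n k)%N /\ (k <= n k)%N.
Hypothesis hA : A_ k @[k --> \oo] --> A.
Hypothesis uA : A \in unitmx.
Local Notation point k := (lattice_point (n k) (A_ k) (v_ k)).

Variables (H : 'M[R]_d) (hk : nat -> V -> R) (h0 : R).
Hypotheses (symH : H^T = H) (posH : posdef H).
Hypothesis expand : forall eps : R, 0 < eps -> exists2 r : R, 0 < r &
  \forall k \near \oo, forall y, `|y - x0| <= r ->
    `|hk k y - h0 - 2^-1 * qform H (y - x0)| <= eps * `|y - x0| ^+ 2.

Lemma half_congr_sym : (2^-1 *: (A^T *m H *m A))^T = 2^-1 *: (A^T *m H *m A).
Proof. by rewrite linearZ/= !trmx_mul trmxK symH mulmxA. Qed.

Lemma half_congr_posdef : posdef (2^-1 *: (A^T *m H *m A)).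
Proof.
move=> y y0; rewrite -/(qform _ _) qform_scale qform_congr mulr_gt0 ?invr_gt0//.
apply: posH; apply: contra y0 => /eqP Ay.
by rewrite -[y](mulKmx uA) Ay mulmx0.
Qed.

(** With [t = 1 / sqrt n] and [Y] the shifted integer vector of a lattice point
    [x], one has [x - x0 = t ^+ 2 *: (A_k *m Y)]: the exponent [n * (h_k x - h0)]
    is [t ^+ 2 * qform H (A_k *m Y) / 2] up to [o(t ^+ 2 * |Y| ^+ 2)], and so is
    the effect of replacing [A_k] by [A]. *)
Lemma local_gaussian_sum (eta : R) : 0 < eta -> exists2 r0 : R, 0 < r0 &
  forall r : R, 0 < r <= r0 -> \forall k \near \oo,
    `|\sum_(z \in [set z | `|point k z - x0| <= r])
        (Num.sqrt (n k)%:R)^-1 ^+ d * expR (- ((n k)%:R * (hk k (point k z) - h0)))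
      - gauss_mass (2^-1 *: (A^T *m H *m A))| <= eta.
Proof.
move=> eta0.
have [eps eps0 Heps] := gauss_sum_perturbed half_congr_sym half_congr_posdef eta0.
pose L := d%:R * (`|A| + 1).
have L0 : 0 <= L by rewrite mulr_ge0// addr_ge0.
pose e1 := eps / 2 / (L ^+ 2 + 1).
have L21 : 0 < L ^+ 2 + 1 by rewrite ltr_wpDl// sqr_ge0.
have e10 : 0 < e1 by rewrite !divr_gt0.
have [r0 r00 er0] := expand e10.
exists r0 => // r /andP[rgt0 rr0].
pose rho := r / (L + 1).
have L1 : 0 < L + 1 by rewrite ltr_wpDl.
have rho0 : 0 < rho by rewrite divr_gt0.
pose C1 := d%:R ^+ 2 * `|H| * d%:R * L.
have C10 : 0 <= C1 by rewrite !mulr_ge0// sqr_ge0.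
have C11 : 0 < C1 + 1 by rewrite ltr_wpDl.
have e20 : 0 < eps / 2 / (C1 + 1) by rewrite !divr_gt0.
have [C Cr] := lattice_count v_ x0 hn hA uA r.
pose P (t : R) := forall (w : V) (F : set 'cV[int]_d) (q : 'cV[int]_d -> R), finite_set F ->
    (forall z, `|t *: (t *: (toR z + w))| < rho -> F z) ->
    (forall z, F z -> `|q z - t ^+ 2 * qform (2^-1 *: (A^T *m H *m A)) (toR z + w)|
                        <= eps * (t ^+ 2 * `|toR z + w| ^+ 2)) ->
    `|\sum_(z \in F) t ^+ d * expR (- q z) - gauss_mass (2^-1 *: (A^T *m H *m A))| <= eta.
have pert : \forall k \near \oo, P (Num.sqrt (n k)%:R)^-1.
  by apply: (@near_sqrt_n_inv R n hn P); exact: Heps.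
have kA1 := near_matrix hA ltr01.
have kA2 := near_matrix hA e20.
near=> k.
have k0 : (0 < k)%N by near: k; exists 1%N.
have [nk0 _] := hn k0.
have [uk [finF _]] : A_ k \in unitmx /\
    let D := [set z | `|lattice_point (n k) (A_ k) (v_ k) z - x0| <= r] in
    finite_set D /\ \sum_(z \in D) ((n k)%:R^-1 : R) ^+ d <= C by near: k.
have n0 : 0 < (n k)%:R :> R by rewrite ltr0n.
have pertk : P (Num.sqrt (n k)%:R)^-1 by near: k; exact: pert.
set t := (Num.sqrt (n k)%:R)^-1 in pertk *.
have t2 : t ^+ 2 = (n k)%:R^-1 by rewrite /t exprVn sqr_sqrtr ?(ltW n0).
have AkL (y : V) : `|A_ k *m y| <= L * `|y|.
  apply: le_trans (mulmx_norm_le _ _) _; rewrite -mulrA ler_wpM2l// ler_wpM2r//.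
  have -> : A_ k = A + (A_ k - A) by rewrite addrC subrK.
  apply: le_trans (ler_normD _ _) _; rewrite lerD2l; near: k; exact: kA1.
have AL (y : V) : `|A *m y| <= L * `|y|.
  apply: le_trans (mulmx_norm_le _ _) _; rewrite -mulrA ler_wpM2l// ler_wpM2r//.
  by rewrite lerDl.
have /(_ (lattice_shift (n k) (A_ k) (v_ k) x0) [set z | `|point k z - x0| <= r]
  (fun z => (n k)%:R * (hk k (point k z) - h0)) finF) := pertk.
apply=> z /=; rewrite lattice_pointE//; set Y := toR z + _.
  rewrite scalerA -expr2 t2 => Yrho; apply: le_trans (AkL _) _.
  apply: (@le_trans _ _ ((L + 1) * rho)).
    by apply: ler_pM => //; [rewrite lerDl | exact: ltW].
  by rewrite /rho mulrCA divff ?mulr1// gt_eqF.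
move=> ur.
have hx : `|hk k (point k z) - h0 - 2^-1 * qform H (A_ k *m ((n k)%:R^-1 *: Y))|
    <= e1 * `|A_ k *m ((n k)%:R^-1 *: Y)| ^+ 2.
  have : forall y, `|y - x0| <= r0 ->
    `|hk k y - h0 - 2^-1 * qform H (y - x0)| <= e1 * `|y - x0| ^+ 2 by near: k.
  by move=> /(_ (point k z)); rewrite lattice_pointE//; apply; exact: le_trans rr0.
have hq : `|qform H (A_ k *m Y) - qform H (A *m Y)| <= eps * `|Y| ^+ 2.
  apply: le_trans (qform_dist_le _ _ _) _; rewrite -mulmxBl.
  have dA : `|(A_ k - A) *m Y| <= d%:R * (eps / 2 / (C1 + 1)) * `|Y|.
    apply: le_trans (mulmx_norm_le _ _) _; rewrite mulrA ler_wpM2r// ler_wpM2l//.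
    by near: k; exact: kA2.
  apply: (@le_trans _ _ (d%:R ^+ 2 * `|H| * (d%:R * (eps / 2 / (C1 + 1)) * `|Y|)
      * (L * `|Y| + L * `|Y|))).
    by apply: ler_pM; rewrite ?mulr_ge0 ?addr_ge0 ?sqr_ge0// ?lerD// ler_wpM2l ?mulr_ge0 ?sqr_ge0.
  have -> : d%:R ^+ 2 * `|H| * (d%:R * (eps / 2 / (C1 + 1)) * `|Y|) * (L * `|Y| + L * `|Y|)
     = eps * `|Y| ^+ 2 * (C1 / (C1 + 1)).
    by rewrite /C1; field; rewrite gt_eqF.
  rewrite ler_piMr ?mulr_ge0 ?sqr_ge0 ?(ltW eps0)//.
  by rewrite ler_pdivrMr// mul1r lerDl.
move: hx; rewrite -scalemxAr qformZ normrZ exprMn real_normK ?num_real// t2.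
rewrite qform_scale qform_congr.
set p := hk k _ - h0; set QB := qform H (A_ k *m Y) in hq *; set QA := qform H (A *m Y) in hq *.
set N := (n k)%:R in n0 *.
have BY : `|A_ k *m Y| ^+ 2 <= L ^+ 2 * `|Y| ^+ 2.
  by rewrite -exprMn lerXn2r ?nnegrE ?mulr_ge0.
move=> hx.
have -> : N * p - N^-1 * (2^-1 * QA) = N * (p - 2^-1 * (N^-1 ^+ 2 * QB))
    + N^-1 * (2^-1 * (QB - QA)).
  by field; rewrite gt_eqF.
apply: le_trans (ler_normD _ _) _; rewrite !normrM (gtr0_norm n0).
rewrite [`|N^-1|]gtr0_norm ?invr_gt0// [`|2^-1|]gtr0_norm ?invr_gt0//.
have -> : eps * (N^-1 * `|Y| ^+ 2) = N^-1 * (eps / 2 * `|Y| ^+ 2) + N^-1 * (2^-1 * (eps * `|Y| ^+ 2)).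
  by field; rewrite gt_eqF.
apply: lerD; last by rewrite ler_wpM2l ?invr_ge0 ?(ltW n0)// ler_wpM2l ?invr_ge0.
apply: le_trans (ler_wpM2l (ltW n0) hx) _.
have -> : N * (e1 * (N^-1 ^+ 2 * `|A_ k *m Y| ^+ 2)) = N^-1 * (e1 * `|A_ k *m Y| ^+ 2).
  by field; rewrite gt_eqF.
rewrite ler_wpM2l ?invr_ge0 ?(ltW n0)//.
apply: le_trans (ler_wpM2l (ltW e10) BY) _.
rewrite mulrA ler_wpM2r ?sqr_ge0//.
have -> : e1 * L ^+ 2 = eps / 2 * (L ^+ 2 / (L ^+ 2 + 1)) by rewrite /e1; field; rewrite gt_eqF.
rewrite ler_piMr ?divr_ge0 ?(ltW eps0)//.
by rewrite ler_pdivrMr// mul1r lerDl.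
Unshelve. all: by end_near. Qed.

End LocalSum.

(** * Complex-valued sums and limits *)

Section ComplexSums.
Context {R : realType}.

Lemma normc_fsum {T : choiceType} (F : set T) (E : T -> R[i]) (b : T -> R) :
  finite_set F -> (forall z, F z -> Normc.normc (E z) <= b z) ->
  Normc.normc (\sum_(z \in F) E z) <= \sum_(z \in F) b z.
Proof.
move=> finF Eb; rewrite !fsbig_finite//= big_seq [leRHS]big_seq.
elim/big_ind2 : _ => [|x1 x2 y1 y2 h1 h2|z]; first by rewrite Normc.normc0.
  by apply: le_trans (le_normcD _ _) _; exact: lerD.
by rewrite in_fset_set// inE => /Eb.
Qed.

Lemma normc_real (x : R) : Normc.normc x%:C = `|x|.
Proof. by rewrite /Normc.normc /= expr0n/= addr0 sqrtr_sqr. Qed.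

Lemma normc_ge0 (z : R[i]) : 0 <= Normc.normc z.
Proof. by case: z => a b; rewrite sqrtr_ge0. Qed.

Lemma normcB (x y : R[i]) : Normc.normc (x - y) = Normc.normc (y - x).
Proof. by rewrite -normcN opprB. Qed.

Lemma fsum_real {T : choiceType} (F : set T) (a : T -> R) : finite_set F ->
  (\sum_(z \in F) a z)%:C = \sum_(z \in F) (a z)%:C.
Proof. by move=> finF; rewrite !fsbig_finite//= rmorph_sum. Qed.

(** Splits [f z] into [g0] and the deviation from it. *)
Lemma weighted_sum_near {T : choiceType} (F : set T) (f : T -> R[i]) (a : T -> R)
    (g0 : R[i]) (c eps eta : R) : finite_set F -> (forall z, F z -> 0 <= a z) ->
  0 <= eps -> (forall z, F z -> Normc.normc (f z - g0) <= eps) ->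
  `|\sum_(z \in F) a z - c| <= eta ->
  Normc.normc (\sum_(z \in F) f z * (a z)%:C - g0 * c%:C)
    <= eps * (c + eta) + Normc.normc g0 * eta.
Proof.
move=> finF a0 eps0 fg ac.
have -> : \sum_(z \in F) f z * (a z)%:C - g0 * c%:C =
   \sum_(z \in F) (f z - g0) * (a z)%:C + g0 * (\sum_(z \in F) a z - c)%:C.
  rewrite rmorphB/= fsum_real// !fsbig_finite//= mulrBr mulr_sumr addrA -big_split/=.
  by congr (_ - _); apply: eq_bigr => z _; rewrite mulrBl subrK.
apply: le_trans (le_normcD _ _) _; apply: lerD; last first.
  by rewrite Normc.normcM normc_real ler_wpM2l// normc_ge0.
apply: le_trans (normc_fsum (b := fun z => eps * a z) finF _) _.
  move=> z Fz; rewrite Normc.normcM normc_real ger0_norm ?a0//.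
  by rewrite ler_wpM2r ?a0 ?fg.
rewrite -mulr_fsumr ler_wpM2l// -lerBlDl.
by apply: le_trans ac; exact: ler_norm.
Qed.

Lemma cvg_normc (u : nat -> R[i]) (l : R[i]) :
  (forall e : R, 0 < e -> \forall k \near \oo, Normc.normc (u k - l) <= e) ->
  u k @[k --> \oo] --> (l : R[i]^o).
Proof.
move=> ul; apply/(@cvgrPdist_le _ R[i]^o nat \oo _ (u : nat -> R[i]^o) l) => -[e e'] /=; rewrite ltcE/= => /andP[/eqP -> e0].
have := ul e e0; apply: filterS => k ke.
by rewrite -[`|_|]/((Normc.normc _)%:C) normcB lecR.
Qed.

Lemma continuous_normc {V : normedModType R} (g : V -> R[i]) (x0 : V) (e : R) :
  {for x0, continuous (g : V -> R[i]^o)} -> 0 < e ->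
  exists2 r : R, 0 < r & forall y, `|y - x0| <= r -> Normc.normc (g y - g x0) <= e.
Proof.
move=> gc e0; have eC : 0 < e%:C by rewrite ltcR.
have /cvgrPdist_le/(_ _ eC) : (g : V -> R[i]^o) y @[y --> x0] --> (g x0 : R[i]^o) by exact: gc.
move=> /nbhs_ballP[r /= r0 rP]; exists (r / 2); first by rewrite divr_gt0.
move=> y yr; have := rP y; rewrite -[`|g x0 - g y|]/((Normc.normc _)%:C) normcB lecR; apply.
rewrite -ball_normE/= distrC.
by apply: le_lt_trans yr _; rewrite ltr_pdivrMr// mulr_natr mulr2n ltrDl.
Qed.

End ComplexSums.

Lemma bounded_dist {R : realType} {d : nat} (W : set 'cV[R]_d) (x0 : 'cV[R]_d) :
  bounded_set W -> exists b : R, forall x, W x -> `|x - x0| <= b.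
Proof.
move=> [B [_ HB]]; exists (B + 1 + `|x0|) => x Wx.
by apply: le_trans (ler_normB _ _) _; rewrite lerD2r; apply: HB => //; rewrite ltrDl.
Qed.

(** * Asymptotics of the lattice sum *)

Theorem theorem2p8 (R : realType) (d : nat) (hd : (1 <= d)%N)
  (W : set 'cV[R]_d) (hW : bounded_set W)
  (n : nat -> nat) (A_ : nat -> 'M[R]_d) (v_ : nat -> 'cV[R]_d)
  (A : 'M[R]_d) (v : 'cV[R]_d)
  (hn : forall k, (0 < k)%N -> (0 < n k)%N /\ (k <= n k)%N)
  (hv : v_ k @[k --> \oo] --> v)
  (hA : A_ k @[k --> \oo] --> A)
  (hAunit : A \in unitmx)
  (S_ g_ : nat -> 'cV[R]_d -> R[i]) (h_ : nat -> 'cV[R]_d -> R)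
  (x0 : 'cV[R]_d) (N0 : set 'cV[R]_d)
  (g : 'cV[R]_d -> R[i]) (h : 'cV[R]_d -> R)
  (hL : discrete_laplace W (fun k => lattice (n k) (A_ k) (v_ k))
          g_ h_ x0 N0 g h)
  (hS : exists2 CS : R, 0 <= CS &
    forall k, (0 < k)%N ->
    forall x, (W `&` lattice (n k) (A_ k) (v_ k)) x ->
      Normc.normc (S_ k x)
        <= CS * Normc.normc (g_ k x) * expR (- ((n k)%:R * h_ k x)))
  (hSlim : supnorm (N0 `&` lattice (n k) (A_ k) (v_ k))
      (fun x => Normc.normc (S_ k x * (expR ((n k)%:R * h_ k x))%:C - g_ k x))
      @[k --> \oo] --> 0%E) :
  ((n k)%:R `^ (- (d%:R / 2)) * expR ((n k)%:R * h x0))%:C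
    * (\sum_(x \in W `&` lattice (n k) (A_ k) (v_ k)) S_ k x)
    @[k --> \oo] -->
  (((2 * pi) `^ (d%:R / 2))%:C * g x0
    / (`|\det A| * Num.sqrt (\det (hessian h x0)))%:C : R[i]^o).
Proof.
case: hL => _ oN0 N0x0 N0W C2hk gc C2h gk_cvg hk_cvg hkx0 gradk posH liminf
  [Cg Cg0 [l growth]].
case: hS => CS CS0 hS.
set H := hessian h x0 in posH *.
have symH : H^T = H := hessian_sym oN0 N0x0 C2h.
have detH : 0 < \det H by case: (gauss_sum_bounds symH posH).
set M := 2^-1 *: (A^T *m H *m A).
set c := gauss_mass M.
have c0 : 0 <= c by exact: sqrtr_ge0.
have -> : ((2 * pi) `^ (d%:R / 2))%:C * g x0 / (`|\det A| * Num.sqrt (\det H))%:C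
    = g x0 * c%:C.
  by rewrite /c gauss_mass_congr// [in RHS]rmorphM/= [in RHS]fmorphV/= mulrAC mulrC.
apply: cvg_normc => e e0.
have [b Wb] := bounded_dist x0 hW.
have [C count] := lattice_count v_ x0 hn hA hAunit b.
pose G := Normc.normc (g x0).
have G0 : 0 <= G := normc_ge0 _.
(* The terms near [x0] contribute at most [3 * eta * (c + eta) + G * eta] to the
   error: [3 * eta] bounds the distance of the weighted terms to [g x0]. *)
pose q := 3 * (c + 1) + G + 1.
have q0 : 0 < q by rewrite ltr_wpDl// addr_ge0// mulr_ge0// addr_ge0.
pose eta := Num.min 1 (e / 2 / q).
have eta0 : 0 < eta by rewrite lt_min ltr01 !divr_gt0.
have eta1 : eta <= 1 by rewrite ge_min lexx.
have etaq : eta * q <= e / 2 by rewrite -ler_pdivlMr// ge_min lexx orbT.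
have expand eps : 0 < eps -> exists2 r : R, 0 < r &
    \forall k \near \oo, forall y, `|y - x0| <= r ->
    `|h_ k y - h x0 - 2^-1 * qform H (y - x0)| <= eps * `|y - x0| ^+ 2.
  move=> eps0.
  have [r [r0 _ rP]] := uniform_quadratic_expansion oN0 N0x0 C2hk C2h hk_cvg gradk eps0.
  exists r => //; have k1 : \forall k \near \oo, (0 < k)%N by exists 1%N.
  by apply: filterS2 k1 rP => k k0 + y yr => /(_ y yr); rewrite hkx0.
have [r0 r00 localr] := local_gaussian_sum v_ hn hA hAunit symH posH expand eta0.
have [r1 r10 r1P] := continuous_normc (gc x0 (mem_set N0x0)) eta0.
have [r2 r20 r2P] := C2_near oN0 N0x0 C2h ltr01.
pose r := Num.min r0 (Num.min r1 r2).
have rgt0 : 0 < r by rewrite !lt_min r00 r10.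
have rr1 y : `|y - x0| <= r -> `|y - x0| <= r1.
  by rewrite !le_min => /and3P[].
have rN0 y : `|y - x0| <= r -> N0 y.
  by rewrite !le_min => /and3P[_ _ /r2P[]].
have /localr loc : 0 < r <= r0 by rewrite rgt0 ge_min lexx.
have gk_near := supnorm_cvg0 gk_cvg eta0.
have S_near := supnorm_cvg0 hSlim eta0.
have oB : open (ball x0 r) by exact: ball_open.
have [eta' eta'0 far] := limn_einf_gt (liminf _ oB (ballxx x0 rgt0)).
have [E E0 decay] := exprn_expR_le (l + d) eta'0.
pose X := CS * Cg * C * E.
have large := n_large hn (X / (e / 2)).
near=> k.
have k0 : (0 < k)%N by near: k; exists 1%N.
have [nk0 kn] := hn k k0.
have n0 : 0 < (n k)%:R :> R by rewrite ltr0n.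
have [uk [finD sumD]] : A_ k \in unitmx /\
    let D := [set z | `|lattice_point (n k) (A_ k) (v_ k) z - x0| <= b] in
    finite_set D /\ \sum_(z \in D) ((n k)%:R^-1 : R) ^+ d <= C by near: k.
have gk : forall x, (N0 `&` lattice (n k) (A_ k) (v_ k)) x ->
    `|Normc.normc (g_ k x - g x)| <= eta by near: k.
have Sk : forall x, (N0 `&` lattice (n k) (A_ k) (v_ k)) x ->
    `|Normc.normc (S_ k x * (expR ((n k)%:R * h_ k x))%:C - g_ k x)| <= eta by near: k.
have lock : `|\sum_(z \in [set z | `|lattice_point (n k) (A_ k) (v_ k) z - x0| <= r])
   (Num.sqrt (n k)%:R)^-1 ^+ d
     * expR (- ((n k)%:R * (h_ k (lattice_point (n k) (A_ k) (v_ k) z) - h x0))) - c| <= eta.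
  by near: k.
have fark : ((h x0 + eta')%:E <=
    ereal_inf [set (h_ k x)%:E | x in W `\` ball x0 r])%E by near: k.
have largek : X / (e / 2) < (n k)%:R by near: k.
set pt := lattice_point (n k) (A_ k) (v_ k) in finD sumD lock.
set t := (Num.sqrt (n k)%:R)^-1 in lock.
set N := (n k)%:R in n0 largek lock sumD *.
have t0 : 0 < t by rewrite invr_gt0 sqrtr_gt0.
have tE : N `^ (- (d%:R / 2)) = t ^+ d.
  by rewrite powRN mulrC powRrM powR_mulrn ?powR_ge0// powR12_sqrt ?(ltW n0)// exprVn.
have N1 : 1 <= N by rewrite /N ler1n.
have td1 : t ^+ d <= 1.
  rewrite exprn_ile1 ?(ltW t0)// invf_le1 ?sqrtr_gt0//.
  by rewrite -[leLHS]sqrtr1 ler_wsqrtr.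
set a := _ * expR _.
pose Z := [set z | W (pt z)].
pose F := [set z | `|pt z - x0| <= r].
have ZD : Z `<=` [set z | `|pt z - x0| <= b] by move=> z /Wb.
have finZ : finite_set Z by exact: sub_finite_set finD.
have FZ : F `<=` Z by move=> z /rN0 /N0W.
have finF : finite_set F by exact: sub_finite_set finZ.
have Lpt z : lattice (n k) (A_ k) (v_ k) (pt z) by exists z.
have -> : \sum_(x \in W `&` lattice (n k) (A_ k) (v_ k)) S_ k x = \sum_(z \in Z) S_ k (pt z).
  apply: reindex_fsbig; split.
  - by move=> z Zz; split=> //; exact: Lpt.
  - by move=> z z' _ _; exact: lattice_point_inj.
  - by move=> x [Wx [z _ zx]]; exists z; rewrite // /Z/= /pt /lattice_point zx.
rewrite (fsbigID F Z)// (setIidr FZ) mulrDr addrAC.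
apply: le_trans (le_normcD _ _) _; rewrite [leRHS]splitr; apply: lerD.
(* Near [x0]: [S_k] is the product of [f], which is close to [g x0], and of the
   weights [w], which sum up to about [c]. *)
- pose f z := S_ k (pt z) * (expR (N * h_ k (pt z)))%:C.
  pose w z := t ^+ d * expR (- (N * (h_ k (pt z) - h x0))).
  have -> : a%:C * (\sum_(z \in F) S_ k (pt z)) = \sum_(z \in F) f z * (w z)%:C.
    rewrite mulr_fsumr; apply: eq_fsbigr => z _; rewrite /f /w -mulrA -rmorphM mulrC.
    congr (_ * _%:C); rewrite /a tE mulrCA -expRD; congr (_ * expR _).
    by rewrite mulrBr opprB addrC subrK.
  have fg z : F z -> Normc.normc (f z - g x0) <= 3 * eta.
    move=> Fz; have NL : (N0 `&` lattice (n k) (A_ k) (v_ k)) (pt z).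
      by split; [exact: rN0 | exact: Lpt].
    have e1 := le_trans (ler_norm _) (Sk _ NL).
    have e2 := le_trans (ler_norm _) (gk _ NL).
    have e3 := r1P _ (rr1 _ Fz).
    have -> : f z - g x0 = (f z - g_ k (pt z)) + ((g_ k (pt z) - g (pt z)) + (g (pt z) - g x0)).
      by rewrite [X in _ = _ + X]addrA subrK addrA subrK.
    apply: le_trans (le_normcD _ _) _.
    have -> : 3 * eta = eta + (eta + eta) by ring.
    apply: lerD => //; apply: le_trans (le_normcD _ _) _; exact: lerD.
  have w0 z : F z -> 0 <= w z by rewrite mulr_ge0 ?exprn_ge0 ?expR_ge0 ?(ltW t0).
  have eta30 : 0 <= 3 * eta by rewrite mulr_ge0 ?(ltW eta0).
  apply: le_trans (weighted_sum_near finF w0 eta30 fg lock) _.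
  apply: le_trans etaq; rewrite -/G.
  have : eta * (c + eta) <= eta * (c + 1) by rewrite ler_wpM2l ?(ltW eta0)// lerD2l.
  by rewrite /q; have := ltW eta0; lra.
(* Far from [x0]: at most [C * N ^+ d] terms, each of them bounded by [B]. *)
- rewrite mulr_fsumr.
  pose B := CS * Cg * N ^+ l * expR (- (N * eta')).
  have B0 : 0 <= B by rewrite !mulr_ge0 ?exprn_ge0 ?expR_ge0 ?(ltW n0).
  have term z : (Z `&` ~` F) z -> Normc.normc (a%:C * S_ k (pt z)) <= B.
    move=> [Zz nFz]; rewrite Normc.normcM normc_real ger0_norm ?mulr_ge0 ?powR_ge0 ?expR_ge0//.
    have hk : h x0 + eta' <= h_ k (pt z).
      rewrite -lee_fin; apply: le_trans fark _; apply: ereal_inf_lbound; exists (pt z) => //.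
      split=> // zr; apply: nFz; rewrite /F/=.
      by move: zr; rewrite -ball_normE/= distrC => /ltW.
    have gkz : Normc.normc (g_ k (pt z)) <= Cg * N ^+ l.
      apply: (@le_trans _ _ (Cg * k%:R ^+ l)).
        apply: le_trans (ler_norm _) _; rewrite -lee_fin; apply: le_trans (growth k k0).
        by apply: (@supnorm_ge _ _ _ (fun x => Normc.normc (g_ k x))); split.
      by rewrite ler_wpM2l// lerXn2r ?nnegrE ?ler0n// ler_nat.
    have WLz : (W `&` lattice (n k) (A_ k) (v_ k)) (pt z) by split.
    apply: le_trans (ler_wpM2l _ (hS k k0 _ WLz)) _.
      by rewrite mulr_ge0 ?powR_ge0 ?expR_ge0.
    rewrite -/N /a tE.
    have -> : t ^+ d * expR (N * h x0) * (CS * Normc.normc (g_ k (pt z)) * expR (- (N * h_ k (pt z))))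
       = t ^+ d * (CS * Normc.normc (g_ k (pt z)) * expR (- (N * (h_ k (pt z) - h x0)))).
      have -> : - (N * (h_ k (pt z) - h x0)) = N * h x0 + - (N * h_ k (pt z)) by ring.
      by rewrite expRD; ring.
    apply: (@le_trans _ _ (1 * (CS * Normc.normc (g_ k (pt z)) * expR (- (N * (h_ k (pt z) - h x0)))))).
      by rewrite ler_wpM2r// !mulr_ge0 ?expR_ge0 ?normc_ge0.
    rewrite mul1r /B -(mulrA CS Cg); apply: ler_pM; rewrite ?mulr_ge0 ?expR_ge0 ?normc_ge0//.
      by rewrite ler_wpM2l.
    by rewrite ler_expR lerN2 ler_wpM2l ?(ltW n0)// lerBrDl.
  have finZF : finite_set (Z `&` ~` F) by exact: finite_setIl.
  apply: le_trans (normc_fsum finZF term) _.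
  have ZFD : Z `&` ~` F `<=` [set z | `|pt z - x0| <= b] by move=> z [/ZD].
  apply: (@le_trans _ _ (\sum_(z \in [set z | `|pt z - x0| <= b]) B)).
    rewrite [leRHS](fsbigID (Z `&` ~` F))//= [X in _ <= \sum_(_ \in X) _ + _]setIidr// lerDl.
    by apply: fsumr_ge0.
  have -> : \sum_(z \in [set z | `|pt z - x0| <= b]) B =
      B * N ^+ d * \sum_(z \in [set z | `|pt z - x0| <= b]) (N^-1 : R) ^+ d.
    rewrite mulr_fsumr; apply: eq_fsbigr => z _.
    by rewrite -mulrA -exprMn divff ?expr1n ?mulr1// gt_eqF.
  apply: le_trans (ler_wpM2l _ sumD) _; first by rewrite mulr_ge0 ?exprn_ge0 ?(ltW n0).
  have -> : B * N ^+ d * C = CS * Cg * C * (N ^+ (l + d) * expR (- (N * eta'))).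
    by rewrite /B exprD; ring.
  have C0 : 0 <= C.
    by apply: le_trans sumD; apply: fsumr_ge0 => z _; rewrite exprn_ge0 ?invr_ge0 ?(ltW n0).
  apply: le_trans (ler_wpM2l _ (decay N n0)) _; first by rewrite !mulr_ge0.
  rewrite mulrA -/X ler_pdivrMr// mulrC -ler_pdivrMr ?divr_gt0//; exact: ltW.
Unshelve. all: by end_near. Qed.
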